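(* Let $\delta\geq 0$, let $(X,d)$ be a locally compact geodesic $\delta$-hyperbolic metric space, and let $\mu$ be a non-collapsing Radon measure on $X$ whose volume entropy $h\geq 0$ is finite. Let $G$ be a second countable locally compact group acting properly by isometries on $X$ and preserving $\mu$. Then for every real number $p>\max\left(1,\frac{h\delta}{\log 2}\right)$, the group $G$ acts properly by affine isometries on an $L^p$-space.
   Context: Hyperbolicity: for $a,x,y\in X$ the Gromov product is $(x|y)_a=\frac12\left(d(x,a)+d(y,a)-d(x,y)\right)$, and $X$ is $\delta$-hyperbolic if $(x|y)_a\geq\min\{(x|z)_a,(y|z)_a\}-\delta$ for all $a,x,y,z\in X$. A Radon measure $\mu$ on $X$ is non-collapsing if there exist constants $C\geq 0$ and $v>0$ such that $\mu(B(x,C))\geq v$ for all $x\in X$, where $B(x,C)$ is the ball of radius $C$ centred at $x$. The volume entropy of $\mu$ is $h=\limsup_{r\to\infty}\frac{\log\mu(B(x,r))}{r}$, which does not depend on $x\in X$. The action of $G$ on $X$ is proper in the following sense: for every $x\in X$ and every sequence $(g_n)$ in $G$ leaving every compact subset of $G$, $d(x,g_nx)\to\infty$. An $L^p$-space is a space $L^p(Z)$ for some measure space $Z$. An action of $G$ by affine isometries on a normed space $V$ is given by a representation $\lambda$ of $G$ by linear isometries of $V$ and a map $c:G\to V$ with $c(gh)=c(g)+\lambda(g)c(h)$ for all $g,h\in G$, the action being $gv=\lambda(g)v+c(g)$. It is proper if for every sequence $(g_n)$ in $G$ leaving every compact subset of $G$ one has $\|c(g_n)\|\to\infty$ (equivalently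 $\|g_nv\|\to\infty$ for all $v\in V$). *)

(* Defs.v *)
From HB Require Import structures.
From mathcomp Require Import all_boot all_order all_algebra.
From mathcomp Require Import all_classical all_reals all_analysis.
From mathcomp Require Import measurable_realfun ess_sup_inf.

Set Implicit Arguments.
Unset Strict Implicit.
Unset Printing Implicit Defensive.

Import Order.TTheory GRing.Theory Num.Theory.
Import numFieldNormedType.Exports.

Local Open Scope classical_set_scope.
Local Open Scope ring_scope.

(* The library defines L^p as a type of classes of functions modulo almost
   everywhere equality, without algebraic structure or norm; this section makes
   it a normed module. Lspace_normE, Lspace_addE and Lspace_scaleE recover the
   operations in terms of the underlying functions. *)
Section LspaceNormed.
Context {d : measure_display} {T : measurableType d} {R : realType}.
Variables (mu : {measure set T -> \bar R}) (p : \bar R) (p1 : (1 <= p)%E).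

Local Notation Lp := (LspaceType mu p1).
Local Notation Lf := (LfunType mu p1).
Local Notation Mq := {mfun_ mu, T >-> measurableTypeR R}.
Local Open Scope quotient_scope.

Lemma Lnorm_ae (f g : T -> R) :
  measurable_fun setT f -> measurable_fun setT g -> f = g %[ae mu] ->
  'N[mu]_p[EFin \o f]%E = 'N[mu]_p[EFin \o g]%E.
Proof.
move=> mf mg fg; move: p1; rewrite unlock /Lnorm; case: (p) => [r r1|_|//].
- congr (_ `^ _)%E; apply: ae_eq_integral => //.
  + apply: (measurableT_comp (measurable_poweR r)).
    by apply: (measurableT_comp (@abse_measurable _ setT)); exact/measurable_EFinP.
  + apply: (measurableT_comp (measurable_poweR r)).
    by apply: (measurableT_comp (@abse_measurable _ setT)); exact/measurable_EFinP.
  + by apply: filterS fg => x /(_ I) fgx _; rewrite /= fgx.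
- case: ifPn => // _; apply: eq_ess_sup.
  by apply: filterS fg => x /(_ I) fgx; rewrite /= fgx.
Qed.

Lemma Lspace_fun_Lfun (u : Lp) : ((u : Mq) : T -> R) \in Lfun mu p.
Proof.
rewrite inE; apply/andP; split; rewrite inE; last exact: Lebesgue_finite.
exact: (@measurable_funPT _ _ T (measurableTypeR R) (repr (u : Mq))).
Qed.

Definition Lspace_repr (u : Lp) : Lf := Lfun_Sub p1 (Lspace_fun_Lfun u).

Definition Lspace_mfun (f : Lf) : {mfun T >-> measurableTypeR R} :=
  HB.pack (f : T -> measurableTypeR R)
    (@isMeasurableFun.Build _ _ T (measurableTypeR R) f
       (@measurable_funPT _ _ T R f)).

Definition Lspace_class (f : Lf) : Mq := \pi_(Mq) (Lspace_mfun f).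

Lemma Lspace_classE (f : Lf) : (Lspace_class f : T -> R) = f %[ae mu].
Proof.
apply/asboolP.
rewrite -[`[< _ >]]/(@ae_eq_op _ _ R T (measurableTypeR R) mu
  (repr (Lspace_class f)) (Lspace_mfun f)).
by rewrite -eqmodE reprK.
Qed.

Lemma Lspace_class_finite (f : Lf) : finite_norm mu p (Lspace_class f : T -> R).
Proof.
rewrite /finite_norm (Lnorm_ae _ _ (Lspace_classE f)) //.
- exact: Lfunction_finite.
- exact: (@measurable_funPT _ _ T (measurableTypeR R) (repr (Lspace_class f))).
Qed.

Definition Lspace_pi (f : Lf) : Lp :=
  HB.pack (Lspace_class f)
    (isFinLebesgue.Build _ _ _ mu p p1 _ (Lspace_class_finite f)).

Lemma Lspace_repr_pi (f : Lf) :
  (Lspace_repr (Lspace_pi f) : T -> R) = f %[ae mu].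
Proof. exact: Lspace_classE. Qed.

Lemma Lspace_inj (u v : Lp) : (u : Mq) = v -> u = v.
Proof.
case: u => [u [[hu]]]; case: v => [v [[hv]]] /= uv.
by case: _ / uv hv => hv; rewrite (Prop_irrelevance hu hv).
Qed.

Lemma Lspace_pi_eq (f g : Lf) :
  (f : T -> R) = g %[ae mu] -> Lspace_pi f = Lspace_pi g.
Proof. by move=> fg; apply/Lspace_inj/eqmodP/asboolP. Qed.

Lemma Lspace_reprK (u : Lp) : Lspace_pi (Lspace_repr u) = u.
Proof.
apply: Lspace_inj; rewrite -[RHS]reprK.
by apply/eqmodP/asboolP; exact: ae_eq_refl.
Qed.

Lemma Lspace_eqP (u v : Lp) :
  u = v <-> (Lspace_repr u : T -> R) = Lspace_repr v %[ae mu].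
Proof.
split=> [->|uv]; first exact: ae_eq_refl.
by rewrite -(Lspace_reprK u) -(Lspace_reprK v); exact: Lspace_pi_eq.
Qed.

Definition Lspace0 : Lp := Lspace_pi 0.
Definition Lspace_opp (u : Lp) : Lp := Lspace_pi (- Lspace_repr u).
Definition Lspace_add (u v : Lp) : Lp :=
  Lspace_pi (Lspace_repr u + Lspace_repr v).
Definition Lspace_scale (a : R) (u : Lp) : Lp := Lspace_pi (a *: Lspace_repr u).
Definition Lspace_norm (u : Lp) : R :=
  fine ('N[mu]_p[EFin \o (Lspace_repr u : T -> R)])%E.

Lemma Lspace_piD (f g : Lf) :
  Lspace_pi (f + g) = Lspace_add (Lspace_pi f) (Lspace_pi g).
Proof.
apply: Lspace_pi_eq; move: (Lspace_repr_pi f) (Lspace_repr_pi g).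
apply: filterS2 => x /(_ I) fx /(_ I) gx _.
by rewrite -[LHS]/(f x + g x) -fx -gx.
Qed.

Lemma Lspace_piZ a (f : Lf) : Lspace_pi (a *: f) = Lspace_scale a (Lspace_pi f).
Proof.
apply: Lspace_pi_eq; move: (Lspace_repr_pi f).
by apply: filterS => x /(_ I) fx _; rewrite -[LHS]/(a * f x) -fx.
Qed.

Lemma Lspace_piN (f : Lf) : Lspace_pi (- f) = Lspace_opp (Lspace_pi f).
Proof.
apply: Lspace_pi_eq; move: (Lspace_repr_pi f).
by apply: filterS => x /(_ I) fx _; rewrite -[LHS]/(- f x) -fx.
Qed.

Lemma Lspace_norm_pi (f : Lf) :
  Lspace_norm (Lspace_pi f) = fine ('N[mu]_p[EFin \o (f : T -> R)])%E.
Proof. by congr fine; apply: Lnorm_ae => //; exact: Lspace_repr_pi. Qed.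

Let addA : associative Lspace_add.
Proof.
move=> u v w; rewrite -(Lspace_reprK u) -(Lspace_reprK v) -(Lspace_reprK w).
by rewrite -!Lspace_piD addrA.
Qed.

Let addC : commutative Lspace_add.
Proof. by move=> u v; rewrite /Lspace_add addrC. Qed.

Let add0 : left_id Lspace0 Lspace_add.
Proof.
by move=> u; rewrite -(Lspace_reprK u) /Lspace0 -Lspace_piD add0r.
Qed.

Let addN : left_inverse Lspace0 Lspace_opp Lspace_add.
Proof.
by move=> u; rewrite -(Lspace_reprK u) -Lspace_piN -Lspace_piD addNr.
Qed.

HB.instance Definition _ := gen_eqMixin Lp.
HB.instance Definition _ := gen_choiceMixin Lp.
HB.instance Definition _ := GRing.isZmodule.Build Lp addA addC add0 addN.

Let scaleA a b (u : Lp) :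
  Lspace_scale a (Lspace_scale b u) = Lspace_scale (a * b) u.
Proof. by rewrite -(Lspace_reprK u) -!Lspace_piZ scalerA. Qed.

Let scale1 : left_id 1 Lspace_scale.
Proof. by move=> u; rewrite -(Lspace_reprK u) -Lspace_piZ scale1r. Qed.

Let scaleDr : right_distributive Lspace_scale +%R.
Proof.
move=> a u v; rewrite -(Lspace_reprK u) -(Lspace_reprK v).
by rewrite -[_ + _]Lspace_piD -!Lspace_piZ scalerDr Lspace_piD.
Qed.

Let scaleDl (u : Lp) : {morph Lspace_scale^~ u : a b / a + b}.
Proof.
by move=> a b; rewrite -(Lspace_reprK u) -!Lspace_piZ scalerDl Lspace_piD.
Qed.

HB.instance Definition _ :=
  GRing.Zmodule_isLmodule.Build R Lp scaleA scale1 scaleDr scaleDl.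

Let norm_leD (u v : Lp) : Lspace_norm (u + v) <= Lspace_norm u + Lspace_norm v.
Proof. by rewrite Lspace_norm_pi ler_LnormD. Qed.

Let normZ a (u : Lp) : Lspace_norm (a *: u) = `|a| * Lspace_norm u.
Proof.
apply: EFin_inj; rewrite Lspace_norm_pi EFinM !finite_norm_fine.
exact: LnormZ.
Qed.

Let norm_eq0 (u : Lp) : Lspace_norm u = 0 -> u = 0.
Proof.
by move=> /fine_Lnormr_eq0 u0; rewrite -(Lspace_reprK u); exact: Lspace_pi_eq.
Qed.

HB.instance Definition _ :=
  Lmodule_isNormed.Build R Lp norm_leD normZ norm_eq0.

Lemma Lspace_normE (u : Lp) :
  `|u| = fine ('N[mu]_p[EFin \o ((u : Mq) : T -> R)])%E.
Proof. by []. Qed.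

Lemma Lspace_addE (u v : Lp) :
  (((u + v : Lp) : Mq) : T -> R) = (u : Mq) \+ (v : Mq) %[ae mu].
Proof. exact: Lspace_classE. Qed.

Lemma Lspace_scaleE a (u : Lp) :
  (((a *: u : Lp) : Mq) : T -> R) = a \*: ((u : Mq) : T -> R) %[ae mu].
Proof. exact: Lspace_classE. Qed.

End LspaceNormed.

HB.mixin Record isTopologicalGroup G of Group G & Topological G := {
  mulg_continuous : continuous (fun x : G * G => (x.1 * x.2)%g);
  invg_continuous : continuous (fun x : G => x^-1%g)
}.

#[short(type="topologicalGroupType")]
HB.structure Definition TopologicalGroup :=
  {G of Group G & Topological G & isTopologicalGroup G}.

(* Measurable types are pointed in the library, so a metric space carrying
   Borel measures has to be pointed, i.e. nonempty. *)
#[short(type="pmetricType")]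
HB.structure Definition PointedMetric (R : numDomainType) :=
  {X of Pointed X & Metric R X}.

Notation borel X := (g_sigma_algebraType (@open X)).

Section MetricSpaces.
Context {R : realType}.

Definition gromov_product {X : metricType R} (a x y : X) : R :=
  (mdist x a + mdist y a - mdist x y) / 2.

Definition hyperbolic (X : metricType R) (delta : R) :=
  forall a x y z : X,
    Num.min (gromov_product a x z) (gromov_product a y z) - delta <=
    gromov_product a x y.

Definition geodesic_space (X : metricType R) :=
  forall x y : X, exists gamma : R -> X,
    [/\ gamma 0 = x, gamma (mdist x y) = y &
      {in `[0, mdist x y] &, forall s t,
         mdist (gamma s) (gamma t) = `|s - t|}].

Record radon_measure {X : pmetricType R}
    (mu : {measure set (borel X) -> \bar R}) : Prop := {
  radon_compact : forall K : set X, compact K -> (mu K < +oo)%E;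
  radon_outer : forall A : set (borel X), measurable A ->
    mu A = ereal_inf [set mu U | U in [set U : set X | open U /\ A `<=` U]];
  radon_inner : forall U : set X, open U ->
    mu U = ereal_sup [set mu K | K in [set K : set X | compact K /\ K `<=` U]]
}.

(* [ball x r] is the open ball. Enlarging C, or r by 1, shows that closed balls
   give the same notions of non-collapsing measure and of entropy. *)
Definition non_collapsing {X : pmetricType R}
    (mu : {measure set (borel X) -> \bar R}) :=
  exists C v : R, [/\ 0 <= C, 0 < v & forall x : X, (v%:E <= mu (ball x C))%E].

(* [lne] takes 0 to -oo and +oo to +oo, so finiteness of the entropy forces
   balls to have finite measure. *)
Definition volume_entropy {X : pmetricType R}
    (mu : {measure set (borel X) -> \bar R}) (x : X) : \bar R :=
  limf_esup (fun r : R => (lne (mu (ball x r)) * (r^-1)%:E)%E) (pinfty_nbhs R).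

End MetricSpaces.

(* Each compact set contains only finitely many terms of the sequence. *)
Definition leaves_compacts {G : topologicalType} (g : nat -> G) :=
  forall K : set G, compact K -> \forall n \near \oo, ~ K (g n).

Section Actions.
Context {R : realType} {G : topologicalGroupType}.

Record isometric_action {X : metricType R} (act : G -> X -> X) : Prop := {
  isometric_action1 : forall x, act 1%g x = x;
  isometric_actionM : forall g h x, act (g * h)%g x = act g (act h x);
  isometric_action_dist : forall g x y, mdist (act g x) (act g y) = mdist x y
}.

Definition proper_action {X : metricType R} (act : G -> X -> X) :=
  forall (x : X) (g : nat -> G), leaves_compacts g ->
    mdist x (act (g n) x) @[n --> \oo] --> +oo.

Definition measure_preserving_action {X : pmetricType R}
    (mu : {measure set (borel X) -> \bar R}) (act : G -> X -> X) :=
  forall (g : G) (A : set (borel X)), measurable A -> mu (act g @^-1` A) = mu A.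

(* The action itself is g v = lambda g v + c g. *)
Record affine_isometric_action {V : normedModType R}
    (lambda : G -> {linear V -> V}) (c : G -> V) : Prop := {
  affine_linear1 : forall v, lambda 1%g v = v;
  affine_linearM : forall g h v, lambda (g * h)%g v = lambda g (lambda h v);
  affine_linear_norm : forall g v, `|lambda g v| = `|v|;
  affine_cocycle : forall g h, c (g * h)%g = c g + lambda g (c h)
}.

Definition proper_affine_action {V : normedModType R} (c : G -> V) :=
  forall g : nat -> G, leaves_compacts g -> `|c (g n)| @[n --> \oo] --> +oo.

End Actions.

Definition acts_properly_on_Lp (R : realType) (G : topologicalGroupType)
    (p : R) :=
  exists (d : measure_display) (Z : measurableType d)
    (nu : {measure set Z -> \bar R}) (p1 : (1 <= p%:E)%E)
    (lambda : G -> {linear LspaceType nu p1 -> LspaceType nu p1})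
    (c : G -> LspaceType nu p1),
    affine_isometric_action lambda c /\ proper_affine_action c.

(* Main.v *)
Require Import Defs.
From HB Require Import structures.
From mathcomp Require Import all_boot all_order all_algebra.
From mathcomp Require Import all_classical all_reals all_analysis.
From mathcomp Require Import finmap ring lra zify measurable_realfun.

Import Order.TTheory GRing.Theory Num.Theory.
Import numFieldNormedType.Exports.

Local Open Scope classical_set_scope.
Local Open Scope ring_scope.

(* Choose [eps > 0] with [eps * delta <= ln 2] and [p * eps > h]. Seen from a
   point [x], the kernel [exp (- eps (a|b)_x)] is a quasi-metric with constant
   2, so by Frink's lemma it is comparable to the chain pseudo-metric
   [theta_x] it generates. On the ball of radius [Lam] around [x] put the Gibbs
   density proportional to [exp (- T(x) * theta_x(a, y))] with respect to
   [mu(dy)], where the inverse temperature [T(x)] is of the order of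
   [log mu(B(x, Lam))], and let [F_a(x, y)] be its [p]-th root: an equivariant
   family of functions on [X * X].

   Softness of the densities and the triangle inequality for [theta_x] give
   [int_y |F_a - F_b|^p <= const * (T(x) exp (- eps (a|b)_x))^p]. As [T] grows
   at most linearly and [p * eps > h], this is integrable in [x]. Conversely,
   if [x] is near a geodesic from [a] to [b], far from the endpoints, then
   low temperature makes the densities of [a] and [b] concentrate on disjoint
   sets, the directions of [a] and of [b], however large the ball is; so
   [int_y |F_a - F_b|^p] is bounded below, and [||F_a - F_b||^p] grows at
   least linearly in [d(a, b)]. The cocycle is [c(g) = F_{g x0} - F_{x0}]. *)

(** * Frink metrization *)

Section QuasiMetric.
Context {R : realType} {T : Type} (rho : T -> T -> R).
Hypothesis rho_ge0 : forall x y, 0 <= rho x y.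

Fixpoint chain_sum (a : T) (s : seq T) (y : T) : R :=
  if s is z :: s' then rho a z + chain_sum z s' y else rho a y.

(** The largest function below [rho] that satisfies the triangle inequality. A chain has at least
    one link, even from a point to itself, so [chain_dist a a] may be positive. *)
Definition chain_dist (a y : T) : R :=
  inf (range (fun s => chain_sum a s y)).

Lemma chain_sum_ge0 a s y : 0 <= chain_sum a s y.
Proof. by elim: s a => [|z s IH] a //=; rewrite addr_ge0. Qed.

Lemma chain_sumE a s y :
  chain_sum a s y =
  \sum_(0 <= k < (size s).+1) rho (nth y (a :: s) k) (nth y (a :: s) k.+1).
Proof.
elim: s a => [|z s IH] a /=; first by rewrite big_nat1.
by rewrite big_nat_recl// IH.
Qed.

Lemma chain_dist_ge0 a y : 0 <= chain_dist a y.
Proof.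
apply: lb_le_inf; first by exists (chain_sum a [::] y); exists [::].
by move=> _ [s _ <-]; exact: chain_sum_ge0.
Qed.

Lemma chain_dist_le_sum a s y : chain_dist a y <= chain_sum a s y.
Proof.
apply: ge_inf; last by exists s.
by exists 0 => _ [s' _ <-]; exact: chain_sum_ge0.
Qed.

Lemma chain_dist_le a y : chain_dist a y <= rho a y.
Proof. exact: (chain_dist_le_sum a [::] y). Qed.

Lemma chain_dist_triangle a b y : chain_dist a y <= rho a b + chain_dist b y.
Proof.
rewrite -lerBlDl; apply: lb_le_inf.
  by exists (chain_sum b [::] y); exists [::].
move=> _ [s _ <-]; rewrite lerBlDl; exact: (chain_dist_le_sum a (b :: s) y).
Qed.

Hypothesis rho_quasi :
  forall x y z, rho x y <= 2 * Num.max (rho x z) (rho z y).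

(* Frink's metrization lemma. The longest tail that still carries half of
   [rho (u i) (u j)] starts at some [p]; then both [rho (u i) (u p.+1)] and
   [rho (u p) (u j)] carry at least half, and induction applies to each. *)
Lemma quasi_metric_chain (u : nat -> T) i j : (i < j)%N ->
  rho (u i) (u j) <= 2 * (\sum_(i <= k < j) rho (u k) (u k.+1) +
                          \sum_(i.+1 <= k < j.-1) rho (u k) (u k.+1)).
Proof.
pose w i j := \sum_(i <= k < j) rho (u k) (u k.+1).
have w_ge0 k l : 0 <= w k l by apply: sumr_ge0.
rewrite -/(w i j) -/(w i.+1 j.-1).
have [n] := ubnP (j - i)%N; elim: n i j => // n IH i j lt_n ij.
have [tail_last|not_last] := leP (rho (u i) (u j)) (2 * rho (u j.-1) (u j)).
  have -> : w i j = w i j.-1 + rho (u j.-1) (u j).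
    by case: j ij {lt_n tail_last} => // j ij /=; rewrite /w big_nat_recr.
  have := w_ge0 i j.-1; have := w_ge0 i.+1 j.-1; lra.
have exP : exists p, (i <= p < j)%N && (2 * rho (u p.+1) (u j) < rho (u i) (u j)).
  have ij1 : (i.+1 < j)%N.
    rewrite ltn_neqAle ij andbT; apply/eqP => ji; move: not_last.
    rewrite -ji /=; have := rho_ge0 (u i) (u i.+1); lra.
  exists j.-2; have -> : j.-2.+1 = j.-1 by lia.
  by rewrite not_last andbT; lia.
pose p := ex_minn exP.
have [ip pj tail_small tail_large] : [/\ (i <= p)%N, (p < j)%N,
    2 * rho (u p.+1) (u j) < rho (u i) (u j) &
    rho (u i) (u j) <= 2 * rho (u p) (u j)].
  rewrite /p; case: ex_minnP => q /andP[/andP[iq qj] lt_q] min_q; split=> //.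
  have [->|neq] := eqVneq q i; first by have := rho_ge0 (u i) (u j); lra.
  rewrite leNgt; apply/negP => lt_q'.
  have := min_q q.-1; have -> : (q.-1.+1 = q)%N by lia.
  by rewrite lt_q' andbT => /(_ ltac:(lia)); lia.
have pj' : (p.+1 < j)%N.
  rewrite ltn_neqAle pj andbT; apply/eqP => pj'.
  move: tail_large not_last; rewrite -pj' /=; lra.
have head_large : rho (u i) (u j) <= 2 * rho (u i) (u p.+1).
  have := rho_quasi (u i) (u j) (u p.+1).
  rewrite maxEle; case: ifP => // _; lra.
have [ip'|neq_ip] := eqVneq p i.
  have -> : w i j = rho (u i) (u i.+1) + w i.+1 j by rewrite /w big_ltn.
  have := w_ge0 i.+1 j; have := w_ge0 i.+1 j.-1; rewrite -ip'.
  by move: head_large; rewrite -ip'; lra.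
(* Add the two halves. The link from [p] to [p.+1] lies in both subchains and in the interior of
   neither, but in the interior of the whole chain, so the sums recombine exactly. *)
have := IH i p.+1 ltac:(lia) ltac:(lia); have := IH p j ltac:(lia) ltac:(lia).
have -> : w i j = w i p + w p j by rewrite /w -big_cat_nat//; lia.
have -> : w i.+1 j.-1 = w i.+1 p + rho (u p) (u p.+1) + w p.+1 j.-1.
  rewrite /w -addrA -big_ltn; last lia.
  by rewrite -big_cat_nat//; lia.
have -> : w i p.+1 = w i p + rho (u p) (u p.+1) by rewrite /w big_nat_recr.
by rewrite /=; lra.
Qed.

(** Interior links count twice in [quasi_metric_chain] and end links once, so every chain sum is at
    least a quarter of [rho a y]. *)
Lemma frink a y : rho a y <= 4 * chain_dist a y.
Proof.
rewrite mulrC -ler_pdivrMr//; apply: lb_le_inf.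
  by exists (chain_sum a [::] y); exists [::].
move=> _ [s _ <-]; rewrite ler_pdivrMr//.
have := quasi_metric_chain (nth y (a :: s)) 0 (size s).+1 isT.
rewrite -chain_sumE /= nth_default// => /le_trans; apply.
have : \sum_(1 <= k < size s) rho (nth y (a :: s) k) (nth y (a :: s) k.+1)
    <= chain_sum a s y.
  rewrite chain_sumE; case: (posnP (size s)) => [->|s0].
    by rewrite big_geq// big_nat1.
  rewrite [leRHS]big_nat_recr// [in leRHS]big_ltn//= addrAC ler_wpDl// addr_ge0//.
rewrite /=; lra.
Qed.

End QuasiMetric.

(** * Separability and measurability on the product *)

Section Separability.
Context {R : realType} {X : pmetricType R}.

Definition dense_seq (e : nat -> X) :=
  forall (x : X) (r : R), 0 < r -> exists n, mdist (e n) x < r.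

(** The points of [e] need not lie in the ball, so the property passes to every ball contained in
    this one. *)
Definition dense_on_ball (x : X) (r : R) (e : nat -> X) :=
  forall y s, mdist x y < r -> 0 < s -> exists n, mdist (e n) y < s.

Lemma open_mball (x : X) (r : R) : open (ball x r).
Proof.
rewrite openE => y; rewrite ballEmdist /= => xy; apply/nbhs_ballP.
exists (r - mdist x y); first by rewrite /= subr_gt0.
move=> z; rewrite !ballEmdist /=; have := metric_triangle x y z; lra.
Qed.

Lemma compact_dense_seq (K : set X) : compact K ->
  exists e : nat -> X, forall y s, K y -> 0 < s -> exists n, mdist (e n) y < s.
Proof.
rewrite compact_cover => cK.
have net k : exists D : {fset X},
    forall y, K y -> exists2 x, x \in D & mdist x y < k.+1%:R^-1.
  have [|D _ KD] := cK X K (fun x => ball x k.+1%:R^-1) (fun x _ => open_mball x _).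
    by move=> y Ky; exists y => //; rewrite ballEmdist /= mdistxx invr_gt0.
  exists D => y /KD[x xD]; rewrite ballEmdist => ?; exists x => //.
have {net}[D KD] := choice net.
(* Enumerate the union of the finite nets of scale [1/(k+1)] over all [k]. *)
pose elt (ki : nat * nat) := nth point (enum_fset (D ki.1)) ki.2.
exists (fun n => oapp elt point (choice.unpickle n)) => y s Ky s0.
have [k] := ltr_add_invr s0; rewrite add0r => ks.
have [x xD xy] := KD k y Ky.
exists (choice.pickle (k, index x (enum_fset (D k))));
rewrite choice.pickleK /= /elt nth_index//.
exact: lt_trans ks.
Qed.

Lemma locally_compact_dense_on_ball : locally_compact [set: X] ->
  forall x : X, exists2 r, 0 < r & exists e, dense_on_ball x r e.
Proof.
move=> lc x; have [U xU [cU _]] := lc x I.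
have /nbhs_ballP[r /= r0 rU] : nbhs x U.
  have : \forall y \near x, [set: X] y -> U y := xU.
  by apply: filterS => y /(_ I).
exists r => //; have [e eU] := compact_dense_seq _ cU.
by exists e => y s xy s0; apply: eU => //; apply: rU; rewrite ballEmdist.
Qed.

Lemma geodesic_connected (A : set X) (x0 : X) : geodesic_space X -> A x0 ->
  open A -> open (~` A) -> A = [set: X].
Proof.
move=> geo Ax0 oA oAc; apply/seteqP; split => // z _.
have [gamma [g0 g1 gE]] := geo x0 z.
pose d := mdist x0 z; have d0 : 0 <= d := mdist_ge0 _ _.
(* [gamma] is controlled only on the segment; clamping the parameter makes it a 1-Lipschitz map on
   the whole line. *)
pose clamp (t : R) := Num.max 0 (Num.min t d).
have clampP t : clamp t \in `[0, d].
  by rewrite in_itv /= /clamp le_max lexx ge_max d0 ge_min lexx orbT.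
pose f t := gamma (clamp t).
have clampB s t : `|clamp s - clamp t| <= `|s - t|.
  have := ler_norm (s - t); have := ler_norm (t - s).
  rewrite distrC ler_norml /clamp !maxEle !minEle.
  by case: (leP s d) => ?; case: (leP t d) => ?; rewrite ?d0;
    case: (leP 0 s) => ?; case: (leP 0 t) => ? ? ?; apply/andP; split; lra.
have cf : continuous (f : R -> X).
  move=> t; apply/cvg_ballP => r r0; near=> s.
  rewrite ballEmdist /= /f gE ?clampP//; apply: le_lt_trans (clampB _ _) _.
  by near: s; apply: (@cvgr_dist_lt _ R^o _ _ _ id).
have := @connected_continuous_connected _ _ _ _ (@segment_connected R 0 d)
  (continuous_subspaceT cf).
set F := [set f x | x in _] => /(_ (F `&` A)) FA.
have : F `&` A = F.
  apply: FA.
  - exists x0; split => //; exists 0; first by rewrite /= in_itv /= lexx.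
    by rewrite /f /clamp min_l// max_l// g0.
  - by exists A.
  - by exists A => //; rewrite -openC.
move/seteqP => [_ /(_ z)] [] //; exists d; first by rewrite /= in_itv /= lexx d0.
by rewrite /f /clamp min_l// max_r// g1.
Unshelve. all: by end_near.
Qed.

(* The points reached from [point] by finitely many steps, each inside a
   countable dense subset of a separable ball, have clopen closure. *)
Lemma geodesic_dense_seq : locally_compact [set: X] -> geodesic_space X ->
  exists e, dense_seq e.
Proof.
move=> lc geo.
(* [E] picks a sequence dense on the ball of radius [1/(k+1)] around [x] whenever one exists, and a
   default one otherwise. *)
have /choice[E EP] : forall xk : X * nat, exists e, forall e',
    dense_on_ball xk.1 xk.2.+1%:R^-1 e' -> dense_on_ball xk.1 xk.2.+1%:R^-1 e.
  move=> xk; have [[e ?]|no] := pselect (exists e, dense_on_ball xk.1 xk.2.+1%:R^-1 e).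
    by exists e.
  by exists (fun _ => point) => e' ?; case: no; exists e'.
pose pt := foldr (fun kn x => E (x, kn.1) kn.2) (point : X).
pose A := [set z | forall s : R, 0 < s -> exists l, mdist (pt l) z < s].
suff AT : A = [set: X].
  exists (fun n => oapp pt point (choice.unpickle n)) => x r r0.
  have : A x by rewrite AT.
  by move=> /(_ _ r0)[l ?]; exists (choice.pickle l); rewrite choice.pickleK.
apply: (geodesic_connected A point geo).
- by move=> s s0; exists [::]; rewrite /= mdistxx.
- rewrite openE => z Az; apply/nbhs_ballP.
  have [r r0 [e zr]] := locally_compact_dense_on_ball lc z.
  (* Some reached point is within half of [1/(k+1)] of [z]. Its ball of radius [1/(k+1)] stays
     inside the separable ball around [z] and contains the ball of half that radius around [z],
     which one more step therefore approximates. *)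
  have [k] := ltr_add_invr (divr_gt0 r0 (ltr0n R 4)); rewrite add0r => kr.
  have k0 : 0 < k.+1%:R^-1 :> R by rewrite invr_gt0.
  exists (k.+1%:R^-1 / 2); first by rewrite /= divr_gt0.
  have [l lz] := Az _ (divr_gt0 k0 (ltr0n R 2)).
  have dl : dense_on_ball (pt l) k.+1%:R^-1 e.
    move=> y s ly s0; apply: zr => //.
    have := metric_triangle z (pt l) y; rewrite (metric_sym z (pt l)).
    by move: kr k0 lz ly; set q := (_^-1); lra.
  move=> y; rewrite ballEmdist /= => zy s s0.
  have [|n ns] := EP (pt l, k) e dl y s _ s0.
    rewrite /=; have := metric_triangle (pt l) z y.
    by move: zy lz; set q := (_^-1); lra.
  by exists ((k, n) :: l).
- rewrite openE => z /= Az; apply/nbhs_ballP.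
  have [s s0 ls] : exists2 s : R, 0 < s & forall l, s <= mdist (pt l) z.
    move/existsNP: Az => -[s] /not_implyP[s0 /forallNP ns]; exists s => // l.
    by rewrite leNgt; apply/negP.
  exists (s / 2); first by rewrite /= divr_gt0.
  move=> y; rewrite ballEmdist /= => zy.
  move=> /(_ (s / 2)) []; first by rewrite divr_gt0.
  move=> l; have := ls l; have := metric_triangle (pt l) y z.
  rewrite (metric_sym y z); lra.
Qed.

Lemma measurable_mball (x : X) (r : R) : measurable (ball x r : set (borel X)).
Proof. by apply: sub_sigma_algebra; exact: open_mball. Qed.

Lemma measurable_mdist (x : X) :
  measurable_fun setT (mdist x : borel X -> R).
Proof.
move=> _; apply: (measurability _ (RGenCInfty.measurableE R)) => //.
move=> _ [_ [r ->] <-]; rewrite setTI.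
rewrite (_ : _ @^-1` _ = ~` ball x r).
  by apply: measurableC; exact: measurable_mball.
rewrite ballEmdist; apply/seteqP; split => z /=; rewrite in_itv /= andbT leNgt;
  by move/negP.
Qed.

Definition prod_open (U : set (X * X)) := forall z, U z -> exists2 r : R, 0 < r &
  forall w, mdist z.1 w.1 < r -> mdist z.2 w.2 < r -> U w.

(** Measurability refers to the product of the two Borel sigma-algebras: separability makes the open
    set a countable union of products of balls with centres in [e] and radii [1/(k+1)]. *)
Lemma measurable_prod_open (e : nat -> X) (U : set (borel X * borel X)) :
  dense_seq e -> prod_open U -> measurable U.
Proof.
move=> de oU.
pose box (ijk : nat * nat * nat) : set (borel X * borel X) :=
  ball (e ijk.1.1) ijk.2.+1%:R^-1 `*` ball (e ijk.1.2) ijk.2.+1%:R^-1.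
have -> : U = \bigcup_(ijk in [set ijk | box ijk `<=` U]) box ijk.
  apply/seteqP; split => [[x y] Uxy|z [ijk sub]]; last exact: sub.
  have [r /= r0 rU] := oU _ Uxy.
  have [k] := ltr_add_invr (divr_gt0 r0 (ltr0n R 2)); rewrite add0r => kr.
  have k0 : 0 < k.+1%:R^-1 :> R by rewrite invr_gt0.
  have [i xi] := de x _ k0; have [j yj] := de y _ k0.
  exists (i, j, k); last by split; rewrite ballEmdist.
  move=> [x' y'] [] /=; rewrite !ballEmdist /= => xi' yj'; apply: rU => /=.
    have := metric_triangle x (e i) x'; rewrite (metric_sym x (e i)).
    by move: kr xi xi'; set q := (_^-1); lra.
  have := metric_triangle y (e j) y'; rewrite (metric_sym y (e j)).
  by move: kr yj yj'; set q := (_^-1); lra.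
rewrite bigcup_mkcond; apply: countable_bigcupT_measurable => // ijk.
case: ifP => // _; by apply: measurableX; exact: measurable_mball.
Qed.

Lemma measurable_fun_usc (e : nat -> X) (f : borel X * borel X -> R) :
  dense_seq e -> (forall r : R, prod_open [set z | f z < r]) ->
  measurable_fun setT f.
Proof.
move=> de fo _; apply: (measurability _ (RGenCInfty.measurableE R)) => //.
move=> _ [_ [r ->] <-]; rewrite setTI.
rewrite (_ : _ @^-1` _ = ~` [set z | f z < r]).
  by apply: measurableC; exact: (measurable_prod_open e _ de (fo r)).
apply/seteqP; split => z /=; rewrite in_itv /= andbT leNgt; first by move/negP.
by move/negP.
Qed.
End Separability.

(** * Roots of probability densities *)

Section PowerInequalities.
Context {R : realType}.
Implicit Types p s u v : R.

(** If [v <= u], then [u - v <= (1 - exp (-s)) u <= s u], and the larger of the two powers is at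
    most their sum. *)
Lemma powR_dist_le p s u v : 0 < p -> 0 <= s -> 0 <= u -> 0 <= v ->
  u <= expR s * v -> v <= expR s * u ->
  `|u - v| `^ p <= s `^ p * (u `^ p + v `^ p).
Proof.
wlog uv : u v / v <= u => [H p0 s0 u0 v0 h1 h2|].
  have [vu|uv] := leP v u; first exact: H.
  by rewrite distrC [_ + v `^ p]addrC; apply: H => //; exact: ltW.
move=> p0 s0 u0 v0 us vs; rewrite ger0_norm ?subr_ge0//.
have uvs : u - v <= s * u.
  have := expR_ge1Dx (- s); rewrite expRN => e1.
  have : u * (expR s)^-1 <= v by rewrite ler_pdivrMr ?expR_gt0// mulrC.
  by have := ler_wpM2l u0 e1; lra.
apply: (@le_trans _ _ ((s * u) `^ p)).
  by apply: ge0_ler_powR; rewrite ?nnegrE ?subr_ge0 ?mulr_ge0// ltW.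
rewrite powRM//; apply: ler_wpM2l; first exact: powR_ge0.
by rewrite lerDl powR_ge0.
Qed.

(** Either [v <= u/2], and then [|u - v| >= u/2], or [v] itself exceeds [u/2]. *)
Lemma powR_dist_ge p u v : 0 < p -> 0 <= u -> 0 <= v ->
  2 `^ (- p) * u `^ p <= `|u - v| `^ p + v `^ p.
Proof.
move=> p0 u0 v0; rewrite powRN ler_pdivrMl ?powR_gt0//.
have [vle|vgt] := leP v (u / 2).
  apply: (@le_trans _ _ (2 `^ p * `|u - v| `^ p)); last first.
    by rewrite ler_wpM2l ?powR_ge0// lerDl powR_ge0.
  rewrite -powRM//; apply: ge0_ler_powR; rewrite ?nnegrE ?mulr_ge0//.
    exact: ltW.
  by rewrite ger0_norm; lra.
apply: (@le_trans _ _ (2 `^ p * v `^ p)); last first.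
  by rewrite ler_wpM2l ?powR_ge0// lerDr powR_ge0.
rewrite -powRM//; apply: ge0_ler_powR; rewrite ?nnegrE ?mulr_ge0//.
  exact: ltW.
lra.
Qed.

End PowerInequalities.

Section RootDensity.
Context {d : measure_display} {T : measurableType d} {R : realType}.
Variables (mu : {measure set T -> \bar R}) (p : R).
Hypothesis p_gt0 : 0 < p.
Local Open Scope ereal_scope.

(** When [N] is the integral of [G], this is the root of a probability density, whose [p]-th power
    has integral 1. *)
Definition root_density (G : T -> R) (N : R) (y : T) : R := ((G y / N) `^ p^-1)%R.

Lemma root_densityX (G : T -> R) N y : (forall y, (0 <= G y)%R) -> (0 < N)%R ->
  (root_density G N y `^ p = G y / N)%R.
Proof.
move=> G0 N0; rewrite /root_density -powRrM mulVf ?gt_eqF// powRr1//.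
by rewrite divr_ge0// ltW.
Qed.

Lemma root_density_ge0 (G : T -> R) N y : (0 <= root_density G N y)%R.
Proof. exact: powR_ge0. Qed.

Lemma measurable_root_density (G : T -> R) N :
  measurable_fun setT G -> measurable_fun setT (root_density G N).
Proof.
move=> mG; apply: (measurableT_comp (measurable_powR _)).
exact: measurable_funM.
Qed.

Lemma integral_density (G : T -> R) N (D : set T) : measurable D ->
  measurable_fun setT G -> (forall y, (0 <= G y)%R) -> (0 < N)%R ->
  \int[mu]_(y in D) (G y / N)%:E = (N^-1)%:E * \int[mu]_(y in D) (G y)%:E.
Proof.
move=> mD mG G0 N0; under eq_integral do rewrite mulrC EFinM.
rewrite ge0_integralZl_EFin//.
- by move=> y _; rewrite lee_fin.
- by apply/measurable_EFinP; apply: measurable_funTS.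
- by rewrite invr_ge0 ltW.
Qed.

Section TwoDensities.
Variables (Ga Gb : T -> R) (Na Nb : R).
Hypotheses (mGa : measurable_fun setT Ga) (mGb : measurable_fun setT Gb).
Hypotheses (Ga0 : forall y, (0 <= Ga y)%R) (Gb0 : forall y, (0 <= Gb y)%R).
Hypotheses (Na0 : (0 < Na)%R) (Nb0 : (0 < Nb)%R).
Hypotheses (GNa : \int[mu]_y (Ga y)%:E = Na%:E).
Hypotheses (GNb : \int[mu]_y (Gb y)%:E = Nb%:E).

Let dist_p y := (`|root_density Ga Na y - root_density Gb Nb y| `^ p)%R.

Let measurable_dist_p : measurable_fun setT dist_p.
Proof.
apply: (measurableT_comp (measurable_powR _)).
apply: measurableT_comp => //.
by apply: measurable_funB; exact: measurable_root_density.
Qed.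

Let mass (G : T -> R) N : (forall y, (0 <= G y)%R) -> measurable_fun setT G ->
  (0 < N)%R -> \int[mu]_y (G y)%:E = N%:E -> \int[mu]_y (G y / N)%:E = 1.
Proof.
move=> G0 mG N0 GN.
by rewrite integral_density// GN -EFinM mulVf// gt_eqF.
Qed.

(** The weight and the normalizing constant each contribute a factor [exp t], and the root divides
    the exponent by [p]. *)
Lemma root_density_ratio (t : R) (y : T) (G G' : T -> R) N N' : (0 < N)%R ->
  (0 < N')%R -> (forall y, (0 <= G y)%R) -> (G y <= expR t * G' y)%R ->
  (N' <= expR t * N)%R ->
  (root_density G N y <= expR (2 * t / p) * root_density G' N' y)%R.
Proof.
move=> N0 N'0 G0 GG' NN'; rewrite /root_density.
have -> : expR (2 * t / p) = (expR (2 * t) `^ p^-1)%R.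
  by rewrite /powR gt_eqF ?expR_gt0// expRK mulrC.
have G'0 : (0 <= G' y)%R.
  by have := le_trans (G0 y) GG'; rewrite pmulr_rge0 ?expR_gt0.
have GN0 : (0 <= G' y / N')%R by rewrite divr_ge0// ltW.
rewrite -powRM ?expR_ge0//; apply: ge0_ler_powR.
- by rewrite invr_ge0 ltW.
- by rewrite nnegrE divr_ge0// ltW.
- by rewrite nnegrE mulr_ge0 ?expR_ge0.
rewrite ler_pdivrMr//; apply: (le_trans GG').
have -> : (2 * t = t + t)%R by ring.
have -> : (expR (t + t) * (G' y / N') * N = expR t * G' y * (expR t * N / N'))%R.
  by rewrite expRD; ring.
rewrite ler_peMr// ?mulr_ge0 ?expR_ge0//.
by rewrite ler_pdivlMr// mul1r.
Qed.

(** The bound on the weights passes to their integrals, so [root_density_ratio] applies in both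
    directions; after [powR_dist_le] the two unit masses give the factor 2. *)
Lemma integral_root_density_dist_le (t : R) : (0 <= t)%R ->
  (forall y, (Ga y <= expR t * Gb y)%R) -> (forall y, (Gb y <= expR t * Ga y)%R) ->
  \int[mu]_y (dist_p y)%:E <= (2 * (2 * t / p) `^ p)%:E.
Proof.
move=> t0 ab ba.
have N_le (G G' : T -> R) N N' : (forall y, (0 <= G y)%R) ->
    (forall y, (0 <= G' y)%R) -> measurable_fun setT G' ->
    measurable_fun setT G ->
    \int[mu]_y (G y)%:E = N%:E -> \int[mu]_y (G' y)%:E = N'%:E ->
    (forall y, (G y <= expR t * G' y)%R) -> (N <= expR t * N')%R.
  move=> G0 G'0 mG' mG GN GN' GG'; rewrite -lee_fin EFinM -GN -GN'.
  rewrite -ge0_integralZl_EFin ?expR_ge0//; first last.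
  - exact/measurable_EFinP.
  - by move=> y _; rewrite lee_fin.
  apply: ge0_le_integral => //.
  - by move=> y _; rewrite lee_fin.
  - exact/measurable_EFinP.
  - by apply/measurable_EFinP; exact: measurable_funM.
  - by move=> y _; rewrite -EFinM lee_fin.
pose s : R := (2 * t / p)%R.
have s0 : (0 <= s)%R by rewrite divr_ge0 ?mulr_ge0// ltW.
have mG (G : T -> R) N : measurable_fun setT G ->
    measurable_fun setT (fun y => (G y / N)%:E).
  by move=> mG; apply/measurable_EFinP; exact: measurable_funM.
apply: (@le_trans _ _
    (\int[mu]_y ((s `^ p)%:E * ((Ga y / Na)%:E + (Gb y / Nb)%:E)))).
  apply: ge0_le_integral => //.
  - by move=> y _; rewrite lee_fin powR_ge0.
  - exact/measurable_EFinP.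
  - by apply: emeasurable_funM => //; apply: emeasurable_funD; exact: mG.
  move=> y _; rewrite -EFinD -EFinM lee_fin.
  rewrite -(root_densityX Ga Na y)// -(root_densityX Gb Nb y)//.
  apply: powR_dist_le => //; rewrite ?root_density_ge0//.
    by apply: root_density_ratio => //; apply: N_le GNb GNa _.
  by apply: root_density_ratio => //; apply: N_le GNa GNb _.
have dens_ge0 (G : T -> R) N y : (forall y, (0 <= G y)%R) -> (0 < N)%R ->
    0 <= (G y / N)%:E.
  by move=> G0 N0; rewrite lee_fin divr_ge0// ltW.
rewrite ge0_integralZl_EFin ?powR_ge0//; first last.
- by apply: emeasurable_funD; exact: mG.
- by move=> y _; rewrite adde_ge0// dens_ge0.
rewrite ge0_integralD//; [|by move=> y _; rewrite dens_ge0|exact: mG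
  |by move=> y _; rewrite dens_ge0|exact: mG].
by rewrite !mass// -EFinD -EFinM mulrC.
Qed.

(** On [P] the first density has mass at least [3/4] and the second at most [q 2^(-p)]. Integrating
    [powR_dist_ge] over [P] leaves [2^(-p) (3/4 - q)], which is at least [2^(-p) / 2]. *)
Lemma integral_root_density_dist_ge (P : set T) (q : R) : measurable P ->
  (q <= 1 / 4)%R ->
  \int[mu]_(y in ~` P) (Ga y)%:E <= (q * Na)%:E ->
  \int[mu]_(y in P) (Gb y)%:E <= (q * 2 `^ (- p) * Nb)%:E ->
  (2 `^ (- p) / 2)%:E <= \int[mu]_y (dist_p y)%:E.
Proof.
move=> mP q4 Pa Pb.
have dens_ge0 (G : T -> R) N y : (forall y, (0 <= G y)%R) -> (0 < N)%R ->
    0 <= (G y / N)%:E.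
  by move=> G0 N0; rewrite lee_fin divr_ge0// ltW.
have PcA : \int[mu]_(y in ~` P) (Ga y / Na)%:E <= q%:E.
  rewrite integral_density//; last exact: measurableC.
  by rewrite lee_pdivrMl// -EFinM mulrC.
have PB : \int[mu]_(y in P) (Gb y / Nb)%:E <= (q * 2 `^ (- p))%:E.
  by rewrite integral_density// lee_pdivrMl// -EFinM mulrC.
have PA : (3 / 4)%:E <= \int[mu]_(y in P) (Ga y / Na)%:E.
  have : \int[mu]_(y in P `|` ~` P) (Ga y / Na)%:E = 1.
    by rewrite setUv mass.
  rewrite ge0_integral_setU//; first last.
  - by apply/disj_setPS; rewrite setICr.
  - by move=> y _; exact: dens_ge0.
  - rewrite setUv; apply/measurable_EFinP; exact: measurable_funM.
  - exact: measurableC.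
  move=> sum1; rewrite -(leeD2rE (x := q%:E))//.
  apply: (@le_trans _ _ 1); first by rewrite -EFinD lee_fin; lra.
  by rewrite -sum1 leeD2l.
have Ple : \int[mu]_(y in P) (dist_p y)%:E <= \int[mu]_y (dist_p y)%:E.
  apply: ge0_subset_integral => //; first exact/measurable_EFinP.
  by move=> y _; rewrite lee_fin powR_ge0.
apply: le_trans Ple.
have m2 (G : T -> R) : measurable_fun setT G -> measurable_fun P (fun y : T => (G y)%:E).
  by move=> mG; apply/measurable_EFinP; apply: measurable_funTS.
have key : (2 `^ (- p))%:E * \int[mu]_(y in P) (Ga y / Na)%:E <=
    \int[mu]_(y in P) (dist_p y)%:E + \int[mu]_(y in P) (Gb y / Nb)%:E.
  rewrite -ge0_integralZl_EFin ?powR_ge0//; first last.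
  - by apply: m2; exact: measurable_funM.
  - by move=> y _; exact: dens_ge0.
  rewrite -ge0_integralD//; first last.
  - by apply: m2; exact: measurable_funM.
  - by move=> y _; exact: dens_ge0.
  - exact: m2.
  - by move=> y _; rewrite lee_fin powR_ge0.
  apply: ge0_le_integral => //.
  - by move=> y _; apply: mule_ge0; [rewrite lee_fin powR_ge0|exact: dens_ge0].
  - apply: emeasurable_funM => //.
    by apply: (m2 (fun y => Ga y / Na)%R); exact: measurable_funM.
  - apply: emeasurable_funD; first exact: m2.
    by apply: (m2 (fun y => Gb y / Nb)%R); exact: measurable_funM.
  move=> y _; rewrite -EFinM -EFinD lee_fin.
  have := powR_dist_ge p _ _ p_gt0 (root_density_ge0 Ga Na y)
    (root_density_ge0 Gb Nb y).
  by rewrite !root_densityX.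
rewrite -(leeD2rE (x := (q * 2 `^ (- p))%:E))//.
apply: (@le_trans _ _ ((2 `^ (- p))%:E * (3 / 4)%:E)).
  rewrite -EFinD -EFinM lee_fin.
  by have := powR_gt0 (- p) (ltr0n R 2); nra.
apply: (@le_trans _ _ ((2 `^ (- p))%:E * \int[mu]_(y in P) (Ga y / Na)%:E)).
  by apply: lee_wpmul2l => //; rewrite lee_fin powR_ge0.
by apply: (le_trans key); exact: leeD2l.
Qed.
End TwoDensities.
End RootDensity.

(** * Concentration of Gibbs densities at low temperature *)

Section Concentration.
Context {d : measure_display} {T : measurableType d} {R : realType}.
Variables (mu : {measure set T -> \bar R}).
Local Open Scope ereal_scope.

(* [M] is tuned so that the mass of [B] where [theta >= kappa], at most
   [V * expR (- M * kappa)], is [q] times the lower bound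
   [v * expR (- M * kappa / 2)] for the total mass. *)
Lemma gibbs_concentration (B Y Q : set T) (theta G : T -> R) (v V q kappa N : R) :
  measurable B -> measurable Y -> measurable Q ->
  (0 < v)%R -> (0 < V)%R -> (0 < q)%R -> (0 < kappa)%R ->
  v%:E <= mu Y -> mu B = V%:E -> Y `<=` B ->
  let M := (2 / kappa * (ln (V / v) - ln q))%R in (0 <= M)%R ->
  (forall y, G y = \1_B y * expR (- (M * theta y)))%R ->
  measurable_fun setT G ->
  (forall y, Y y -> theta y <= kappa / 2)%R ->
  (forall y, Q y -> B y -> kappa <= theta y)%R ->
  \int[mu]_y (G y)%:E = N%:E ->
  \int[mu]_(y in Q) (G y)%:E <= (q * N)%:E.
Proof.
move=> mB mY mQ v0 V0 q0 k0 vY BV YB M M0 GE mG Yk Qk GN.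
have G0 y : (0 <= G y)%R by rewrite GE mulr_ge0 ?expR_ge0.
have mGD D : measurable_fun D (fun y => (G y)%:E).
  by apply/measurable_EFinP; apply: measurable_funTS.
have expM : (expR (- (M * kappa)) * V = q * (expR (- (M * (kappa / 2))) * v))%R.
  have -> : (M * kappa = M * (kappa / 2) + (ln (V / v) - ln q))%R.
    by rewrite /M; field; rewrite gt_eqF.
  rewrite opprD expRD -mulrA [in RHS]mulrCA; congr (_ * _)%R.
  rewrite opprB expRD expRN !lnK ?posrE ?divr_gt0//.
  by field; rewrite !gt_eqF.
have Qle : \int[mu]_(y in Q) (G y)%:E <= (expR (- (M * kappa)) * V)%:E.
  apply: (@le_trans _ _ (\int[mu]_(y in Q)
      ((expR (- (M * kappa)))%:E * (\1_B y)%:E))).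
    apply: ge0_le_integral => //.
    - by move=> y _; rewrite lee_fin.
    - apply: emeasurable_funM => //; apply/measurable_EFinP.
      exact: measurable_indic.
    move=> y Qy; rewrite -EFinM lee_fin GE mulrC indicE.
    have [By|] := boolP (y \in B); last by rewrite !mulr0.
    rewrite !mulr1 ler_expR lerN2 ler_wpM2l// Qk//; exact: set_mem.
  rewrite ge0_integralZl_EFin ?expR_ge0//; last first.
    by apply/measurable_EFinP; exact: measurable_indic.
  rewrite integral_indic// EFinM lee_wpmul2l ?lee_fin ?expR_ge0// -BV.
  by apply: le_measure => [|| y []//]; apply/mem_set => //; exact: measurableI.
have Nge : (expR (- (M * (kappa / 2))) * v)%:E <= N%:E.
  rewrite -GN.
  apply: (@le_trans _ _ (\int[mu]_(y in Y) (G y)%:E)); last first.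
    by apply: ge0_subset_integral => // y _; rewrite lee_fin.
  apply: (@le_trans _ _ (\int[mu]_(y in Y) (expR (- (M * (kappa / 2))))%:E)).
    by rewrite integral_cst// EFinM lee_wpmul2l ?lee_fin ?expR_ge0.
  apply: ge0_le_integral => //.
  move=> y Yy; rewrite lee_fin.
  rewrite GE indicE mem_set ?mul1r; last exact: YB.
  by rewrite ler_expR lerN2 ler_wpM2l// Yk.
by apply: (le_trans Qle); rewrite expM lee_fin ler_pM2l// -lee_fin.
Qed.

End Concentration.

(** * Affine actions on L^p from cocycles of functions *)

Lemma LnormE {R : realType} {d : measure_display} {T : measurableType d}
    (mu : {measure set T -> \bar R}) (p : R) (f : T -> R) :
  ('N[mu]_p%:E[EFin \o f] = (\int[mu]_x (`|f x| `^ p)%:E) `^ p^-1)%E.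
Proof. by rewrite unlock. Qed.

Section MeasurePreserving.
Context {d : measure_display} {T : measurableType d} {R : realType}.
Variable mu : {measure set T -> \bar R}.

Definition measure_preserving (f : T -> T) :=
  measurable_fun setT f /\ forall A, measurable A -> mu (f @^-1` A) = mu A.

Lemma ge0_integral_preserving (f : T -> T) (h : T -> \bar R) :
  measure_preserving f -> measurable_fun setT h -> (forall x, 0 <= h x)%E ->
  (\int[mu]_x h (f x) = \int[mu]_x h x)%E.
Proof.
move=> [mf pf] mh h0.
have <- := @ge0_integral_pushforward _ _ _ _ R f mf mu setT h measurableT mh
  (fun y _ => h0 y).
by apply: eq_measure_integral => A mA _; exact: pf.
Qed.

Lemma ae_eq_preserving (f : T -> T) (g h : T -> R) : measure_preserving f ->
  g = h %[ae mu] -> g \o f = h \o f %[ae mu].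
Proof.
move=> [mf pf] [A [mA A0 sA]]; exists (f @^-1` A); split.
- by rewrite -[_ @^-1` _]setTI; exact: mf.
- by rewrite pf.
- by move=> x /= gh; apply: sA => /= gh'; apply: gh => _; exact: gh'.
Qed.

Section LpComposition.
Variables (p : R) (p1 : (1 <= p%:E)%E) (f : T -> T) (pf : measure_preserving f).

Lemma Lnorm_comp (g : T -> R) : measurable_fun setT g ->
  ('N[mu]_p%:E[EFin \o (g \o f)] = 'N[mu]_p%:E[EFin \o g])%E.
Proof.
move=> mg.
have mgp : measurable_fun setT (fun x => (`|g x| `^ p)%:E).
  apply/measurable_EFinP; apply: (measurableT_comp (measurable_powR p)).
  exact: measurableT_comp.
have gp0 x : (0 <= (`|g x| `^ p)%:E)%E by rewrite lee_fin powR_ge0.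
by rewrite !LnormE -(ge0_integral_preserving f _ pf mgp gp0).
Qed.

Lemma Lfun_comp (g : LfunType mu p1) : (g \o f : T -> R) \in Lfun mu p%:E.
Proof.
rewrite inE; apply/andP; split; apply/mem_set.
  by apply: measurableT_comp => //; exact: pf.1.
by rewrite /= /finite_norm Lnorm_comp//; exact: Lfunction_finite.
Qed.

Definition Lfun_precomp (g : LfunType mu p1) : LfunType mu p1 :=
  Lfun_Sub p1 (Lfun_comp g).

Definition Lspace_precomp (u : LspaceType mu p1) : LspaceType mu p1 :=
  Lspace_pi (Lfun_precomp (Lspace_repr u)).

(** Composition does not depend on the representative, since preimages of null sets under [f] are
    null. *)
Lemma Lspace_precomp_pi (g : LfunType mu p1) :
  Lspace_precomp (Lspace_pi g) = Lspace_pi (Lfun_precomp g).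
Proof.
apply: Lspace_pi_eq.
exact: (ae_eq_preserving f _ _ pf (Lspace_repr_pi g)).
Qed.

Lemma Lspace_precomp_linear : linear Lspace_precomp.
Proof.
move=> a u v; rewrite -(Lspace_reprK u) -(Lspace_reprK v).
set g := Lspace_repr u; set h := Lspace_repr v.
have -> : a *: Lspace_pi g + Lspace_pi h = Lspace_pi (a *: g + h).
  by rewrite Lspace_piD Lspace_piZ.
rewrite !Lspace_precomp_pi.
have -> : a *: Lspace_pi (Lfun_precomp g) + Lspace_pi (Lfun_precomp h) =
    Lspace_pi (a *: Lfun_precomp g + Lfun_precomp h).
  by rewrite Lspace_piD Lspace_piZ.
by congr Lspace_pi; apply/LfuneqP.
Qed.

HB.instance Definition _ := GRing.isLinear.Build R (LspaceType mu p1)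
  (LspaceType mu p1) *:%R Lspace_precomp Lspace_precomp_linear.

Lemma Lspace_precomp_norm (u : LspaceType mu p1) : `|Lspace_precomp u| = `|u|.
Proof.
rewrite -(Lspace_reprK u) Lspace_precomp_pi.
rewrite -[LHS]/(Lspace_norm _) -[RHS]/(Lspace_norm _) !Lspace_norm_pi.
by rewrite Lnorm_comp.
Qed.

End LpComposition.
End MeasurePreserving.

(** [lambda g] is composition with [act g^-1], where the inverse restores the order of products, and
    [c g] is the class of [phi g]; the cocycle identity descends from functions to classes. *)
Lemma acts_properly_on_Lp_of_cocycle {R : realType} {d : measure_display}
    {Z : measurableType d} (nu : {measure set Z -> \bar R})
    (G : topologicalGroupType) (p : R) (act : G -> Z -> Z) (phi : G -> Z -> R) :
  1 <= p ->
  (forall z, act 1%g z = z) ->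
  (forall g h z, act (g * h)%g z = act g (act h z)) ->
  (forall g, measure_preserving nu (act g)) ->
  (forall g, phi g \in Lfun nu p%:E) ->
  (forall g h z, phi (g * h)%g z = phi g z + phi h (act g^-1%g z)) ->
  (forall g : nat -> G, leaves_compacts g ->
    fine ('N[nu]_p%:E[EFin \o phi (g n)])%E @[n --> \oo] --> +oo) ->
  acts_properly_on_Lp G p.
Proof.
move=> p_ge1 act1 actM mp phiL phiM phi_oo.
have p1 : (1 <= p%:E)%E by rewrite lee_fin.
pose lambda (g : G) : {linear LspaceType nu p1 -> LspaceType nu p1} :=
  Lspace_precomp nu p p1 (act g^-1%g) (mp g^-1%g).
pose c (g : G) : LspaceType nu p1 := Lspace_pi (Lfun_Sub p1 (phiL g)).
exists d, Z, nu, p1, lambda, c; split; first split.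
- move=> v; rewrite -(Lspace_reprK v) /lambda [LHS]Lspace_precomp_pi.
  by congr Lspace_pi; apply/LfuneqP => z /=; rewrite invg1 act1.
- move=> g h v; rewrite -(Lspace_reprK v) /lambda.
  rewrite [LHS]Lspace_precomp_pi [in RHS]/= 2!Lspace_precomp_pi.
  by congr Lspace_pi; apply/LfuneqP => z /=; rewrite invgM actM.
- by move=> g v; exact: Lspace_precomp_norm.
- move=> g h; rewrite /lambda /= Lspace_precomp_pi -[RHS]Lspace_piD.
  by congr Lspace_pi; apply/LfuneqP => z /=; rewrite phiM.
move=> g /phi_oo; congr (_ @[n --> \oo] --> +oo).
by apply/funext => n; rewrite /c -[RHS]/(Lspace_norm _) Lspace_norm_pi.
Qed.

(** * Volume growth *)

Section Growth.
Context {R : realType} {X : pmetricType R}.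
Variable mu : {measure set (borel X) -> \bar R}.

Lemma le_measure_ball (x y : X) (r s : R) : ball x r `<=` ball y s ->
  (mu (ball x r) <= mu (ball y s))%E.
Proof.
move=> rs; apply: le_measure => //; apply: mem_set.
  exact: (measurable_mball x r).
exact: (measurable_mball y s).
 Qed.

(** Beyond a threshold [r1] the limsup bounds the volume by [exp (h' r)]. Enlarging an arbitrary
    [r >= 0] to [r1 + r] costs the constant [C = exp (h' r1)]. *)
Lemma volume_entropy_growth (x0 : X) (h h' : R) : 0 <= h -> h < h' ->
  volume_entropy mu x0 = h%:E ->
  exists2 C : R, 0 < C & forall r, 0 <= r ->
    (mu (ball x0 r) <= (C * expR (h' * r))%:E)%E.
Proof.
move=> h0 hh'; rewrite /volume_entropy limf_esupE => entropy.
have /ereal_inf_lt[_ [V [r0 [r0_real r0V] <-]] supV] : (ereal_inf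
    [set ereal_sup [set (lne (mu (ball x0 r)) * (r^-1)%:E)%E | r in V] |
      V in pinfty_nbhs R] < h'%:E)%E.
  by rewrite entropy lte_fin.
pose r1 := `|r0| + 1.
have growth r : r1 <= r -> (mu (ball x0 r) <= (expR (h' * r))%:E)%E.
  move=> r1r; have r_gt0 : 0 < r by apply: lt_le_trans r1r; rewrite /r1 ltr_wpDl.
  have Vr : V r by apply: r0V; apply: lt_le_trans r1r; rewrite /r1; have := ler_norm r0; lra.
  have : (lne (mu (ball x0 r)) * (r^-1)%:E <= h'%:E)%E.
    by apply: ltW; apply: le_lt_trans supV; apply: ereal_sup_ubound; exists r.
  rewrite muleC lee_pdivrMl// -EFinM mulrC => le_ln.
  rewrite -[leLHS]lneK ?in_itv /= ?measure_ge0 ?leey//.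
  by rewrite -[leRHS]/(expeR (h' * r)%:E) lee_expeR.
exists (expR (h' * r1)) => [|r r_ge0]; first exact: expR_gt0.
rewrite -expRD -mulrDr; apply: le_trans (growth (r1 + r) _); last by rewrite lerDl.
apply: le_measure_ball => y; rewrite !ballEmdist /=; rewrite /r1.
by have := normr_ge0 r0; lra.
Qed.

Lemma measurable_exp_dist (x0 : X) (beta : R) : measurable_fun setT
  (fun x : borel X => (expR (- (beta * mdist x0 x)))%:E).
Proof.
apply/measurable_EFinP; apply: measurableT_comp => //.
apply: measurableT_comp => //; apply: measurable_funM => //.
exact: measurable_mdist.
Qed.

(** Cut the space into shells [n <= d(x0, x) < n + 1] and bound the volume of each by that of the
    ball of radius [n + 1]: this leaves a geometric series of ratio [exp (h' - beta) < 1]. *)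
Lemma integral_exp_dist (x0 : X) (C h' beta : R) : 0 < C -> h' < beta ->
  0 <= h' ->
  (forall r, 0 <= r -> (mu (ball x0 r) <= (C * expR (h' * r))%:E)%E) ->
  (\int[mu]_x (expR (- (beta * mdist x0 x)))%:E < +oo)%E.
Proof.
move=> C0 h'b h'0 growth.
pose f n (x : borel X) : \bar R :=
  ((expR (- (beta * n%:R)))%:E * (\1_(ball x0 n.+1%:R : set (borel X)) x)%:E)%E.
have f0 n x : (0 <= f n x)%E by rewrite mule_ge0// lee_fin ?expR_ge0.
have mf n : measurable_fun setT (f n).
  apply: emeasurable_funM => //; apply/measurable_EFinP.
  by apply: measurable_indic; exact: measurable_mball.
have mint := measurable_exp_dist x0 beta.
have le_sum : (\int[mu]_x (expR (- (beta * mdist x0 x)))%:E <=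
    \int[mu]_x \sum_(0 <= n <oo) f n x)%E.
  apply: ge0_le_integral => //.
  - exact: ge0_emeasurable_sum.
  move=> x _; have d0 := mdist_ge0 x0 x.
  pose n := Num.truncn (mdist x0 x).
  have /andP[nd dn] := truncn_itv d0.
  apply: (@le_trans _ _ (f n x)).
    rewrite /f indicE mem_set ?mule1; last by rewrite ballEmdist.
    by rewrite lee_fin ler_expR lerN2 ler_wpM2l//; lra.
  rewrite (@nneseriesD1 _ _ n)//.
  by rewrite leeDl// nneseries_ge0.
apply: (le_lt_trans le_sum); rewrite integral_nneseries//.
pose z := expR (h' - beta).
have z1 : z < 1 by rewrite /z -expR0 ltr_expR; lra.
pose K := C * expR h'.
have term n : (\int[mu]_x f n x <= (K * z ^+ n)%:E)%E.
  rewrite ge0_integralZl_EFin ?expR_ge0//; last first.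
    by apply/measurable_EFinP; apply: measurable_indic; exact: measurable_mball.
  rewrite integral_indic ?setIT//; last exact: measurable_mball.
  apply: (@le_trans _ _ ((expR (- (beta * n%:R)))%:E *
      (C * expR (h' * n.+1%:R))%:E)%E).
    by rewrite lee_wpmul2l ?lee_fin ?expR_ge0// growth.
  rewrite -EFinM lee_fin /K /z -expRM_natl mulrCA -mulrA ler_pM2l// -!expRD.
  by rewrite ler_expR -natr1; lra.
apply: (@le_lt_trans _ _ (K / (1 - z))%:E); last exact: ltry.
apply: lime_le; first by apply: is_cvg_nneseries => n _ _; apply: integral_ge0.
apply: nearW => n.
apply: (@le_trans _ _ (\sum_(0 <= i < n) (K * z ^+ i)%:E)%E).
  by apply: lee_sum => i _; exact: term.
rewrite sumEFin lee_fin -mulr_sumr ler_pM2l ?mulr_gt0 ?expR_gt0//.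
rewrite -[leRHS]div1r ler_pdivlMr ?subr_gt0// mulrC big_mkord.
have := subrX1 z n.
have : 0 <= z ^+ n by rewrite exprn_ge0 ?expR_ge0.
lra.
Qed.

End Growth.

(** * The visual pseudo-metrics *)

Section GromovKernel.
Context {R : realType} {X : metricType R}.
Implicit Types (a b x y z : X) (eps : R).

Lemma gromov_product_ge0 x a b : 0 <= gromov_product x a b.
Proof.
have := metric_triangle a x b; rewrite /gromov_product (metric_sym x b); lra.
Qed.

Lemma gromov_product_ge x a b : mdist x a - mdist a b <= gromov_product x a b.
Proof.
have := metric_triangle x b a; rewrite /gromov_product.
rewrite (metric_sym a x) (metric_sym b x) (metric_sym b a); lra.
Qed.

Lemma gromov_product_le x a b y : mdist a b = mdist a y + mdist y b ->
  gromov_product x a b <= mdist x y.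
Proof.
have := metric_triangle a y x; have := metric_triangle b y x.
rewrite /gromov_product (metric_sym y x) (metric_sym b y); lra.
Qed.

Lemma gromov_product_lip x x' a y y' :
  gromov_product x a y - (mdist x x' + mdist y y') <= gromov_product x' a y'.
Proof.
rewrite /gromov_product.
have := metric_triangle a x' x; have := metric_triangle y y' x.
have := metric_triangle y' x' x; have := metric_triangle a y y'.
rewrite (metric_sym x' x); lra.
Qed.

(** Small when [a] and [b] lie far away in the same direction from [x]. It does not vanish for
    [a = b], where it equals [exp (- eps d(x, a))]. *)
Definition gromov_kernel eps x a b : R := expR (- (eps * gromov_product x a b)).

Definition visual_dist eps x a y : R := chain_dist (gromov_kernel eps x) a y.

Lemma gromov_kernel_ge0 eps x a b : 0 <= gromov_kernel eps x a b.
Proof. exact: expR_ge0. Qed.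

Lemma visual_dist_ge0 eps x a y : 0 <= visual_dist eps x a y.
Proof. by apply: chain_dist_ge0 => *; exact: gromov_kernel_ge0. Qed.

Lemma visual_dist_le eps x a y : visual_dist eps x a y <= gromov_kernel eps x a y.
Proof. by apply: chain_dist_le => *; exact: gromov_kernel_ge0. Qed.

Lemma visual_dist_le1 eps x a y : 0 <= eps -> visual_dist eps x a y <= 1.
Proof.
move=> eps0; apply: le_trans (visual_dist_le _ _ _ _) _.
by rewrite -expR0 ler_expR oppr_le0 mulr_ge0// gromov_product_ge0.
Qed.

Lemma visual_dist_triangle eps x a b y :
  visual_dist eps x a y <= gromov_kernel eps x a b + visual_dist eps x b y.
Proof. by apply: chain_dist_triangle => *; exact: gromov_kernel_ge0. Qed.

Lemma gromov_kernel_sym eps x a b : gromov_kernel eps x a b = gromov_kernel eps x b a.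
Proof.
rewrite /gromov_kernel /gromov_product (metric_sym a b); congr expR.
by congr (- (_ * (_ / _))); congr (_ - _); exact: addrC.
Qed.

Section Hyperbolic.
Variables (eps delta : R).
Hypotheses (eps0 : 0 <= eps) (eps_delta : eps * delta <= ln 2).
Hypothesis X_hyp : hyperbolic X delta.

(** Exponentiating the hyperbolic inequality costs the factor [exp (eps delta)], at most 2 by the
    choice of [eps]. *)
Lemma gromov_kernel_quasi x a b z : gromov_kernel eps x a b <=
  2 * Num.max (gromov_kernel eps x a z) (gromov_kernel eps x z b).
Proof.
rewrite (gromov_kernel_sym eps x z b); have := X_hyp x a b z.
have ln2 : 2 = expR (ln 2) :> R by rewrite lnK ?posrE.
rewrite minEle ln2.
have half s : s - delta <= gromov_product x a b ->
    gromov_kernel eps x a b <= expR (ln 2) * expR (- (eps * s)).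
  move=> sd; rewrite -expRD ler_expR.
  by have := ler_wpM2l eps0 sd; rewrite mulrBr; move: eps_delta; lra.
case: ifP => _ /half /le_trans; apply; rewrite ler_pM2l ?expR_gt0//.
  by rewrite le_max lexx.
by rewrite le_max lexx orbT.
Qed.

Lemma gromov_kernel_le_visual x a y :
  gromov_kernel eps x a y <= 4 * visual_dist eps x a y.
Proof.
apply: frink => *; first exact: gromov_kernel_ge0.
exact: gromov_kernel_quasi.
Qed.

(** The constant is 2 from the quasi-metric inequality times 4 from Frink's lemma. It prevents [y]
    from being in the directions of both [a] and [b]. *)
Lemma gromov_kernel_le_max_visual x a b y : gromov_kernel eps x a b <=
  8 * Num.max (visual_dist eps x a y) (visual_dist eps x b y).
Proof.
have := gromov_kernel_quasi x a b y.
rewrite (gromov_kernel_sym eps x y b) => /le_trans; apply.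
have := gromov_kernel_le_visual x a y; have := gromov_kernel_le_visual x b y.
rewrite !maxEle; do 2 case: ifPn; rewrite -?ltNge; lra.
Qed.

End Hyperbolic.

(** In a chain every link changes by a factor at most [exp (eps d(x, x'))], and only the last one by
    a further [exp (eps d(y, y'))]. *)
Lemma visual_dist_lip eps x x' a y y' : 0 <= eps ->
  visual_dist eps x' a y' <=
  expR (eps * (mdist x x' + mdist y y')) * visual_dist eps x a y.
Proof.
move=> eps0.
rewrite -ler_pdivrMl ?expR_gt0// /visual_dist; apply: lb_le_inf.
  by exists (chain_sum (gromov_kernel eps x) a [::] y); exists [::].
move=> _ [s _ <-]; rewrite ler_pdivrMl ?expR_gt0//.
apply: le_trans (chain_dist_le_sum _ _ a s y') _.
  by move=> *; exact: gromov_kernel_ge0.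
have kernel_lip b z z' : gromov_kernel eps x' b z' <=
    expR (eps * (mdist x x' + mdist z z')) * gromov_kernel eps x b z.
  rewrite -expRD ler_expR.
  by have := ler_wpM2l eps0 (gromov_product_lip x x' b z z'); lra.
elim: s a => [|z s IH] a /=; first exact: kernel_lip.
rewrite mulrDr lerD ?IH//; apply: le_trans (kernel_lip a z z) _.
rewrite ler_wpM2r ?gromov_kernel_ge0// ler_expR ler_wpM2l// mdistxx.
by rewrite addr0 lerDl mdist_ge0.
Qed.

Lemma visual_dist_isometry eps (f f' : X -> X) x a y :
  (forall z w, mdist (f z) (f w) = mdist z w) -> cancel f f' -> cancel f' f ->
  visual_dist eps (f x) (f a) (f y) = visual_dist eps x a y.
Proof.
move=> iso fK f'K.
have kernelE z b c : gromov_kernel eps (f z) (f b) (f c) = gromov_kernel eps z b c.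
  by rewrite /gromov_kernel /gromov_product !iso.
congr inf; apply/seteqP; split => _ [s _ <-].
  exists (map f' s) => //; elim: s a => [|z s IH] a /=; first by rewrite kernelE.
  by rewrite IH -kernelE f'K.
exists (map f s) => //; elim: s a => [|z s IH] a /=; first by rewrite kernelE.
by rewrite kernelE IH.
Qed.

End GromovKernel.

(** Upper semicontinuity jointly in the base point and the endpoint, from which the measurability of
    the Gibbs weights follows. *)
Lemma prod_open_visual_dist {R : realType} {X : pmetricType R} (eps : R) (a : X)
  (r : R) : 0 < eps -> prod_open [set z | visual_dist eps z.1 a z.2 < r].
Proof.
move=> eps0 [x y] /= lt_r.
have [t0|t0] := eqVneq (visual_dist eps x a y) 0.
  exists 1 => // -[x' y'] _ _ /=.
  apply: le_lt_trans (visual_dist_lip eps x x' a y y' (ltW eps0)) _.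
  by rewrite t0 mulr0 -t0.
have {}t0 : 0 < visual_dist eps x a y by rewrite lt_neqAle eq_sym t0 visual_dist_ge0.
(* Within this radius the factor in [visual_dist_lip] stays below [r / visual_dist eps x a y]. *)
exists (ln (r / visual_dist eps x a y) / (2 * eps)).
  by rewrite divr_gt0 ?mulr_gt0// ln_gt0// ltr_pdivlMr// mul1r.
have r0 : 0 < r := lt_trans t0 lt_r.
move=> [x' y'] /=; rewrite !ltr_pdivlMr ?mulr_gt0// => dx dy.
apply: le_lt_trans (visual_dist_lip eps x x' a y y' (ltW eps0)) _.
rewrite -ltr_pdivlMr// -ltr_ln ?posrE ?expR_gt0 ?divr_gt0//.
by rewrite expRK; lra.
Qed.

Lemma prod_open_dist {R : realType} {X : pmetricType R} (r : R) :
  prod_open [set z : X * X | mdist z.1 z.2 < r].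
Proof.
move=> [x y] /= xy; exists ((r - mdist x y) / 2); first by rewrite divr_gt0// subr_gt0.
move=> [x' y'] /= dx dy.
have := metric_triangle x' x y'; have := metric_triangle x y y'.
rewrite (metric_sym x' x); lra.
Qed.

(** * Gibbs densities *)

Lemma natr_dist_ge1 {R : realType} (i j : nat) : i != j ->
  (1 : R) <= `|i%:R - j%:R|.
Proof.
wlog ij : i j / (i < j)%N => [H|_].
  by case: (ltngtP i j) => // [ij|ji] _; [|rewrite distrC]; apply: H => //;
    rewrite ltn_eqF.
have : (i.+1%:R <= j%:R :> R) by rewrite ler_nat.
by rewrite distrC -natr1 => ?; apply: le_trans (ler_norm _); lra.
Qed.

Section GibbsStates.
Context {R : realType} {X : pmetricType R}.
Variable mu : {sigma_finite_measure set (borel X) -> \bar R}.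
Variables (eps p kappa v rad Lam : R).

(** The fraction of mass tolerated in wrong directions: at most [1/4], and equal to [1/4] of
    [2^(-p)], as the two mass bounds of [integral_root_density_dist_ge] require. *)
Let q : R := 2 `^ (- p) / 4.

Definition ball_volume (x : X) : R := fine (mu (ball x Lam)).

(** The value [M] of [gibbs_concentration]: balls of larger volume get a lower temperature, so the
    precision [q] is the same for all of them. *)
Definition inverse_temperature (x : X) : R :=
  2 / kappa * (ln (ball_volume x / v) - ln q).

Definition gibbs_weight (a x y : X) : R :=
  \1_(ball x Lam) y * expR (- (inverse_temperature x * visual_dist eps x a y)).

Definition partition_function (a x : X) : R :=
  fine (\int[mu]_(y in [set: borel X]) (gibbs_weight a x y)%:E)%E.

Definition gibbs_root (a : X) (z : X * X) : R :=
  root_density p (gibbs_weight a z.1 : borel X -> R) (partition_function a z.1) z.2.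

Definition gibbs_gap (a b x : X) : \bar R :=
  (\int[mu]_(y in [set: borel X])
     (`|gibbs_root a (x, y) - gibbs_root b (x, y)| `^ p)%:E)%E.

Variable e : nat -> X.
Hypothesis e_dense : dense_seq e.
Hypotheses (eps0 : 0 < eps) (p0 : 0 < p) (kappa0 : 0 < kappa) (v0 : 0 < v).
Hypothesis rad_Lam : rad <= Lam.
Hypothesis ball_ge : forall x, (v%:E <= mu (ball x rad))%E.
Hypothesis ball_fin : forall x r, (mu (ball x r) < +oo)%E.

Let q_gt0 : 0 < q. Proof. by rewrite divr_gt0// powR_gt0. Qed.

Let pow2_le1 : 2 `^ (- p) <= 1 :> R.
Proof.
by rewrite -[leRHS](powRr0 (2 : R)); apply: ler_powR; rewrite ?ler1n// oppr_le0 ltW.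
Qed.

Let q_le : q <= 1 / 4.
Proof. by rewrite /q ler_pM2r ?invr_gt0. Qed.

Lemma mu_ball x : mu (ball x Lam) = (ball_volume x)%:E.
Proof. by rewrite fineK// ge0_fin_numE. Qed.

Lemma ball_volume_ge x : v <= ball_volume x.
Proof.
rewrite -lee_fin -mu_ball; apply: le_trans (ball_ge x) _.
by apply: le_measure_ball => y; rewrite !ballEmdist /= => /lt_le_trans; apply.
Qed.

Lemma ball_volume_gt0 x : 0 < ball_volume x.
Proof. exact: lt_le_trans (ball_volume_ge x). Qed.

Lemma inverse_temperature_ge0 x : 0 <= inverse_temperature x.
Proof.
rewrite /inverse_temperature mulr_ge0 ?divr_ge0 ?(ltW kappa0)// subr_ge0.
apply: (@le_trans _ _ 0); first by apply: ln_le0; move: q_le; lra.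
by rewrite ln_ge0// ler_pdivlMr// mul1r ball_volume_ge.
Qed.

Let measurable_near : measurable
  ([set z | mdist z.1 z.2 < Lam] : set (borel X * borel X)).
Proof. exact: (measurable_prod_open e _ e_dense (prod_open_dist Lam)). Qed.

Let near_xsection (x : X) :
  xsection ([set z | mdist z.1 z.2 < Lam] : set (borel X * borel X)) x = ball x Lam.
Proof.
by rewrite ballEmdist; apply/seteqP; split => y; [move/xsectionP|move=> ?; apply/xsectionP].
Qed.

Lemma measurable_inverse_temperature :
  measurable_fun setT (inverse_temperature : borel X -> R).
Proof.
apply: measurable_funM => //; apply: measurable_funB => //.
apply: measurableT_comp; first exact: measurable_ln.
apply: measurable_funM => //; apply: measurableT_comp => //.
have := measurable_fun_xsection mu measurable_near.
by congr measurable_fun; apply/funext => x /=; rewrite near_xsection.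
Qed.

Lemma measurable_gibbs_weight a : measurable_fun setT
  (fun z : borel X * borel X => gibbs_weight a z.1 z.2).
Proof.
apply: measurable_funM.
  have := measurable_indic measurable_near (R := R) (D := setT).
  congr measurable_fun; apply/funext => z /=; rewrite !indicE; congr ((nat_of_bool _)%:R).
  by apply/idP/idP => /set_mem; rewrite ?ballEmdist => zL; apply/mem_set;
    rewrite ?ballEmdist.
apply: measurableT_comp => //; apply: measurableT_comp => //.
apply: measurable_funM.
  by apply: measurableT_comp => //; exact: measurable_inverse_temperature.
apply: (measurable_fun_usc e) => // r.
exact: prod_open_visual_dist.
Qed.

Lemma measurable_gibbs_weight_section a x :
  measurable_fun setT (gibbs_weight a x : borel X -> R).
Proof. exact: (measurableT_comp (measurable_gibbs_weight a)
  (pair1_measurable (x : borel X))). Qed.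

Lemma gibbs_weight_ge0 a x y : 0 <= gibbs_weight a x y.
Proof. by rewrite mulr_ge0 ?expR_ge0// indicE. Qed.

Let integral_weight_le a x :
  (\int[mu]_(y in [set: borel X]) (gibbs_weight a x y)%:E <=
    (ball_volume x)%:E)%E.
Proof.
rewrite -mu_ball -(setIT (ball x Lam : set (borel X))).
have mB : measurable (ball x Lam : set (borel X)) by exact: measurable_mball.
rewrite -integral_indic//; apply: ge0_le_integral => //.
- by move=> y _; rewrite lee_fin gibbs_weight_ge0.
- by apply/measurable_EFinP; exact: measurable_gibbs_weight_section.
- by apply/measurable_EFinP; exact: measurable_indic.
move=> y _; rewrite lee_fin /gibbs_weight ler_piMr//.
rewrite -expR0 ler_expR oppr_le0 mulr_ge0 ?inverse_temperature_ge0//.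
exact: visual_dist_ge0.
Qed.

Lemma partition_functionE a x :
  (\int[mu]_(y in [set: borel X]) (gibbs_weight a x y)%:E =
    (partition_function a x)%:E)%E.
Proof.
rewrite fineK// ge0_fin_numE; last first.
  by apply: integral_ge0 => y _; rewrite lee_fin gibbs_weight_ge0.
exact: le_lt_trans (integral_weight_le a x) (ltry _).
Qed.

Lemma partition_function_gt0 a x : 0 < partition_function a x.
Proof.
have mB : measurable (ball x Lam : set (borel X)) by exact: measurable_mball.
(* Visual distances are at most 1, which bounds the weight below on the ball. *)
apply: (@lt_le_trans _ _ (expR (- inverse_temperature x) * ball_volume x)).
  by rewrite mulr_gt0 ?expR_gt0 ?ball_volume_gt0.
rewrite -lee_fin -partition_functionE EFinM -mu_ball.
rewrite -(setIT (ball x Lam : set (borel X))) -integral_indic//.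
rewrite -ge0_integralZl_EFin ?expR_ge0//; last first.
  by apply/measurable_EFinP; exact: measurable_indic.
apply: ge0_le_integral => //.
- apply: emeasurable_funM => //; apply/measurable_EFinP; exact: measurable_indic.
- by apply/measurable_EFinP; exact: measurable_gibbs_weight_section.
move=> y _; rewrite -EFinM lee_fin /gibbs_weight mulrC ler_wpM2l//.
rewrite ler_expR lerN2 ler_piMr ?inverse_temperature_ge0//.
by apply: visual_dist_le1; exact: ltW.
Qed.

Lemma measurable_partition_function a :
  measurable_fun setT (partition_function a : borel X -> R).
Proof.
apply: measurableT_comp => //.
apply: (@measurable_fun_fubini_tonelli_F _ _ (borel X) (borel X) R mu
  (fun z => (gibbs_weight a z.1 z.2)%:E)).
- by apply/measurable_EFinP; exact: measurable_gibbs_weight.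
- by move=> z; rewrite lee_fin gibbs_weight_ge0.
Qed.

Lemma measurable_gibbs_root a :
  measurable_fun setT (gibbs_root a : borel X * borel X -> R).
Proof.
apply: (measurableT_comp (measurable_powR _)).
apply: measurable_funM; first exact: measurable_gibbs_weight.
have -> : (fun z : borel X * borel X => (partition_function a z.1)^-1) =
    (fun z => partition_function a z.1 `^ (- 1)).
  by apply/funext => z; rewrite powR_inv1// ltW// partition_function_gt0.
apply: (measurableT_comp (measurable_powR (- 1))).
by apply: measurableT_comp; [exact: measurable_partition_function|exact: measurable_fst].
Qed.

Lemma measurable_root_dist a b : measurable_fun setT (fun z : borel X * borel X =>
  (`|gibbs_root a z - gibbs_root b z| `^ p)%:E).
Proof.
apply/measurable_EFinP; apply: (measurableT_comp (measurable_powR _)).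
apply: measurableT_comp => //.
by apply: measurable_funB; exact: measurable_gibbs_root.
Qed.

Lemma measurable_gibbs_gap a b : measurable_fun setT (gibbs_gap a b : borel X -> _).
Proof.
apply: (@measurable_fun_fubini_tonelli_F _ _ (borel X) (borel X) R mu
  (fun z => (`|gibbs_root a z - gibbs_root b z| `^ p)%:E)).
- exact: measurable_root_dist.
- by move=> z; rewrite lee_fin powR_ge0.
Qed.

Lemma gibbs_gap_ge0 a b x : (0 <= gibbs_gap a b x)%E.
Proof. by apply: integral_ge0 => y _; rewrite lee_fin powR_ge0. Qed.

Lemma integral_gibbs_gap a b :
  (\int[mu \x mu]_(z in [set: borel X * borel X])
     (`|gibbs_root a z - gibbs_root b z| `^ p)%:E =
   \int[mu]_(x in [set: borel X]) gibbs_gap a b x)%E.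
Proof.
apply: (@fubini_tonelli1 _ _ (borel X) (borel X) R mu mu
  (fun z => (`|gibbs_root a z - gibbs_root b z| `^ p)%:E)).
- exact: measurable_root_dist.
- by move=> z; rewrite lee_fin powR_ge0.
Qed.

(** By the triangle inequality for [visual_dist], replacing [a] by [b] changes the exponent of the
    weight by at most the inverse temperature times the kernel. *)
Lemma gibbs_gap_le a b x : (gibbs_gap a b x <=
  (2 * (2 * (inverse_temperature x * gromov_kernel eps x a b) / p) `^ p)%:E)%E.
Proof.
have le_weight c c' y : gibbs_weight c x y <=
    expR (inverse_temperature x * gromov_kernel eps x c c') * gibbs_weight c' x y.
  rewrite /gibbs_weight mulrCA ler_wpM2l ?indicE// -expRD ler_expR.
  have := ler_wpM2l (inverse_temperature_ge0 x) (visual_dist_triangle eps x c' c y).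
  rewrite (gromov_kernel_sym eps x c').
  by move=> le_M; rewrite lerBrDr addrC lerBlDr -mulrDr.
have t0 : 0 <= inverse_temperature x * gromov_kernel eps x a b.
  by rewrite mulr_ge0 ?inverse_temperature_ge0// gromov_kernel_ge0.
have le_ba y := le_weight b a y; rewrite (gromov_kernel_sym eps x b) in le_ba.
exact: (integral_root_density_dist_le mu p p0
  (gibbs_weight a x : borel X -> R) (gibbs_weight b x : borel X -> R)
  (partition_function a x) (partition_function b x)
  (measurable_gibbs_weight_section a x) (measurable_gibbs_weight_section b x)
  (gibbs_weight_ge0 a x) (gibbs_weight_ge0 b x)
  (partition_function_gt0 a x) (partition_function_gt0 b x)
  (partition_functionE a x) (partition_functionE b x) _ t0 (le_weight a b) le_ba).
Qed.

(** * Lower bound for the gap near a geodesic *)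

Section Separation.
Variable delta : R.
Hypotheses (eps_delta : eps * delta <= ln 2) (X_hyp : hyperbolic X delta).

(** The balls around [u] and [w] supply mass [v] in the directions of [a] and [b], so both densities
    concentrate. The set [P] of directions near [a] contains none near [b], because the kernel
    exceeds [8 kappa]. *)
Lemma gibbs_gap_ge (a b x u w : X) :
  (forall y, ball u rad y -> ball x Lam y /\ visual_dist eps x a y <= kappa / 2) ->
  (forall y, ball w rad y -> ball x Lam y /\ visual_dist eps x b y <= kappa / 2) ->
  8 * kappa < gromov_kernel eps x a b ->
  ((2 `^ (- p) / 2)%:E <= gibbs_gap a b x)%E.
Proof.
move=> near_a near_b kab.
pose P : set (borel X) := [set y | visual_dist eps x a y < kappa].
have mP : measurable P.
  have mU : measurable
      ([set z | visual_dist eps z.1 a z.2 < kappa] : set (borel X * borel X)).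
    by apply: (measurable_prod_open e) => //; exact: prod_open_visual_dist.
  have := measurable_xsection (x : borel X) mU; congr measurable.
  by apply/seteqP; split => y; [move/xsectionP|move=> ?; apply/xsectionP].
have mB y r : measurable (ball y r : set (borel X)) by exact: measurable_mball.
have concentration c y0 (Q : set (borel X)) : measurable Q ->
    (forall y, ball y0 rad y -> ball x Lam y /\ visual_dist eps x c y <= kappa / 2) ->
    (forall y, Q y -> kappa <= visual_dist eps x c y) ->
    (\int[mu]_(y in Q) (gibbs_weight c x y)%:E <= (q * partition_function c x)%:E)%E.
  move=> mQ near_c Qk.
  apply: (@gibbs_concentration _ (borel X) R mu (ball x Lam) (ball y0 rad) Q
    (visual_dist eps x c) _ v (ball_volume x) q kappa) => //.
  - exact: ball_volume_gt0.
  - exact: ball_ge.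
  - exact: mu_ball.
  - by move=> y /near_c[].
  - exact: inverse_temperature_ge0.
  - exact: measurable_gibbs_weight_section.
  - by move=> y /near_c[].
  - by move=> y /Qk.
  - exact: partition_functionE.
refine (integral_root_density_dist_ge mu p p0
  (gibbs_weight a x : borel X -> R) (gibbs_weight b x : borel X -> R)
  (partition_function a x) (partition_function b x)
  (measurable_gibbs_weight_section a x) (measurable_gibbs_weight_section b x)
  (gibbs_weight_ge0 a x) (gibbs_weight_ge0 b x)
  (partition_function_gt0 a x) (partition_function_gt0 b x)
  (partition_functionE a x) P (1 / 4) mP (lexx _) _ _).
- apply: le_trans (concentration a u (~` P) (measurableC mP) near_a _) _.
    by move=> y /negP; rewrite -leNgt.
  by rewrite lee_fin ler_pM2r// partition_function_gt0.
- apply: le_trans (concentration b w P mP near_b _) _.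
    move=> y Py; rewrite leNgt; apply/negP => by_lt.
    have := gromov_kernel_le_max_visual eps delta (ltW eps0) eps_delta X_hyp x a b y.
    by move: Py kab; rewrite /P /= maxEle; case: ifP => _; lra.
  by rewrite lee_fin ler_pM2r ?partition_function_gt0// /q; lra.
Qed.

Hypothesis X_geo : geodesic_space X.
Variable L : R.
Hypotheses (rad0 : 0 < rad) (L0 : 0 <= L) (L_Lam : L + 2 * rad <= Lam).
Hypothesis kappa_small : 8 * kappa < expR (- (eps * rad)).
Hypothesis L_large : expR (- (eps * (L - 2 * rad))) <= kappa / 2.

(** The point [u] lies at distance [L] from [z] towards [c], so [(c|u)_z = L]; moving [z] to [x] and
    [u] to [y] loses at most [2 rad]. *)
Lemma visual_dist_small (c x z u y : X) : mdist z x < rad -> ball u rad y ->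
  mdist c z = mdist c u + L -> mdist u z = L ->
  ball x Lam y /\ visual_dist eps x c y <= kappa / 2.
Proof.
rewrite !ballEmdist /= => zx uy cz uz; split.
  have := metric_triangle x z y; have := metric_triangle z u y.
  rewrite (metric_sym x z) (metric_sym z u); move: L_Lam zx uy uz. lra.
apply: le_trans (visual_dist_le _ _ _ _) _; apply: le_trans L_large.
rewrite ler_expR lerN2 ler_wpM2l ?(ltW eps0)//.
apply: le_trans (gromov_product_lip z x c u y).
rewrite /gromov_product; lra.
Qed.

Lemma gibbs_gap_geodesic (a b x : X) (gamma : R -> X) t :
  gamma 0 = a -> gamma (mdist a b) = b ->
  {in `[0, mdist a b] &, forall s t, mdist (gamma s) (gamma t) = `|s - t|} ->
  L <= t -> t + L <= mdist a b -> mdist (gamma t) x < rad ->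
  ((2 `^ (- p) / 2)%:E <= gibbs_gap a b x)%E.
Proof.
move=> ga gb gammaE Lt tL tx.
have D s s' : 0 <= s -> s <= s' -> s' <= mdist a b ->
    mdist (gamma s) (gamma s') = s' - s.
  move=> s0 ss' s'D; have sI : s \in `[0, mdist a b].
    by rewrite in_itv /= s0 (le_trans ss' s'D).
  have s'I : s' \in `[0, mdist a b] by rewrite in_itv /= s'D (le_trans s0 ss').
  by rewrite (gammaE _ _ sI s'I) distrC ger0_norm ?subr_ge0.
have aD s : 0 <= s -> s <= mdist a b -> mdist a (gamma s) = s.
  move=> s0 sD; have := D 0 s (lexx _) s0 sD; by rewrite ga subr0.
have bD s : 0 <= s -> s <= mdist a b -> mdist b (gamma s) = mdist a b - s.
  move=> s0 sD; have := D s _ s0 sD (lexx _); by rewrite gb (metric_sym b).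
have [tL0 tLt t_tL] : [/\ 0 <= t - L, t - L <= t & t <= t + L].
  by move: L0 Lt; split; lra.
have [t0 tL_ge0] : 0 <= t /\ 0 <= t + L by move: L0 Lt; split; lra.
have [tD tLD] : t <= mdist a b /\ t - L <= mdist a b.
  by move: L0 tL tLt; split; lra.
apply: (gibbs_gap_ge a b x (gamma (t - L)) (gamma (t + L))).
- move=> y uy; apply: visual_dist_small tx uy _ _.
    by rewrite aD// aD//; ring.
  by rewrite D//; ring.
- move=> y wy; apply: visual_dist_small tx wy _ _.
    by rewrite bD// bD//; ring.
  by rewrite metric_sym D//; ring.
(* As [gamma t] lies between [a] and [b], the product [(a|b)_x] is below [rad]. *)
apply: lt_le_trans kappa_small _; rewrite ler_expR lerN2 ler_wpM2l ?(ltW eps0)//.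
apply: le_trans (ltW tx); rewrite metric_sym; apply: gromov_product_le.
by rewrite aD// (metric_sym (gamma t)) bD//; ring.
Qed.

(** Place [n] centres on a geodesic, [2 rad] apart and at least [L] away from the ends. The open
    balls of radius [rad] around them are disjoint and of mass at least [v], and
    [gibbs_gap_geodesic] applies on each. *)
Lemma integral_gibbs_gap_ge (a b : X) n : 2 * L + 2 * rad * n%:R <= mdist a b ->
  ((2 `^ (- p) / 2 * v * n%:R)%:E <= \int[mu]_(x in [set: borel X]) gibbs_gap a b x)%E.
Proof.
move=> nD; have [gamma [ga gb gammaE]] := X_geo a b.
pose t (k : nat) := L + 2 * rad * k%:R.
pose B (k : 'I_n) : set (borel X) := ball (gamma (t k)) rad.
have t_ge k : L <= t k by rewrite /t lerDl !mulr_ge0// ltW.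
have t_le (k : 'I_n) : t k + L <= mdist a b.
  apply: le_trans nD; rewrite /t.
  have : 2 * rad * k%:R <= 2 * rad * n%:R.
    by rewrite ler_pM2l ?mulr_gt0// ler_nat ltnW.
  lra.
have mB k : measurable (B k) by exact: measurable_mball.
have disjB : trivIset setT B.
  apply/trivIsetP => i j _ _ ij; apply/seteqP; split => // y [].
  rewrite /B !ballEmdist /= => iy jy.
  have inD (k : 'I_n) : t k \in `[0, mdist a b].
    rewrite in_itv /= (le_trans L0 (t_ge k)) /=.
    by have := t_le k; move: L0; lra.
  have := metric_triangle (gamma (t i)) y (gamma (t j)).
  rewrite (metric_sym y) gammaE// /t opprD addrACA subrr add0r -mulrBr normrM.
  rewrite gtr0_norm ?mulr_gt0//.
  have one : (1 : R) <= `|i%:R - j%:R| by exact: natr_dist_ge1.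
  have := ler_wpM2l (ltW (mulr_gt0 (ltr0n R 2) rad0)) one; lra.
pose U : set (borel X) := \big[setU/set0]_(k < n) B k.
have mU : measurable U by apply: bigsetU_measurable.
have Umu : ((v * n%:R)%:E <= mu U)%E.
  rewrite /U measure_bigsetU_ord//.
  apply: (@le_trans _ _ (\sum_(k < n) v%:E)%E); last by apply: lee_sum => k _; exact: ball_ge.
  by rewrite sumEFin sumr_const card_ord mulr_natr.
apply: (@le_trans _ _ (\int[mu]_(x in U) gibbs_gap a b x)%E); last first.
  apply: ge0_subset_integral => //; first exact: measurable_gibbs_gap.
  by move=> x _; exact: gibbs_gap_ge0.
apply: (@le_trans _ _ (\int[mu]_(x in U) (2 `^ (- p) / 2)%:E)%E).
  rewrite integral_cst// -mulrA EFinM; apply: lee_wpmul2l; last exact: Umu.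
  by rewrite lee_fin divr_ge0 ?powR_ge0.
apply: ge0_le_integral => //.
- by apply: measurable_funTS; exact: measurable_gibbs_gap.
move=> x Ux; have [k] : exists k, B k x.
  move: Ux; rewrite /U; elim/big_rec: _ => [//|k V _ IH [Bk|/IH//]].
  by exists k.
rewrite /B ballEmdist /= => kx.
exact: (gibbs_gap_geodesic a b x gamma _ ga gb gammaE (t_ge _) (t_le _) kx).
Qed.

End Separation.

(** * Integrability of the gap *)

Section Finiteness.
Variables (x0 : X) (C h' : R).
Hypotheses (C0 : 0 < C) (h'0 : 0 <= h') (h'_lt : h' < p * eps) (Lam0 : 0 <= Lam).
Hypothesis growth :
  forall r, 0 <= r -> (mu (ball x0 r) <= (C * expR (h' * r))%:E)%E.

(** The logarithm of the volume grows at most linearly. Trading this for an arbitrarily small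
    exponential rate [s] lets the decay of the kernel absorb it. *)
Lemma inverse_temperature_growth s : 0 < s ->
  exists2 A, 0 <= A & forall x, inverse_temperature x <= A * expR (s * mdist x0 x).
Proof.
move=> s0; pose A0 := `|ln (C / v) + h' * Lam - ln q|.
have hs0 : 0 <= h' / s := divr_ge0 h'0 (ltW s0).
have k0 : 0 <= 2 / kappa := divr_ge0 (ler0n R 2) (ltW kappa0).
exists (2 / kappa * (A0 + h' / s)); first by rewrite mulr_ge0// addr_ge0 ?normr_ge0.
move=> x; have d0 := mdist_ge0 x0 x.
rewrite /inverse_temperature -[leRHS]mulrA ler_wpM2l//.
have lnV : ln (ball_volume x / v) <= ln (C / v) + h' * (mdist x0 x + Lam).
  rewrite -[X in _ + X]expRK -lnM ?posrE ?expR_gt0 ?divr_gt0//.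
  rewrite ler_ln ?posrE ?mulr_gt0 ?expR_gt0 ?invr_gt0 ?ball_volume_gt0//.
  rewrite mulrAC ler_pM2r ?invr_gt0// -lee_fin -mu_ball.
  apply: le_trans (growth _ (addr_ge0 d0 Lam0)).
  apply: le_measure_ball => y; rewrite !ballEmdist /= => xy.
  by have := metric_triangle x0 x y; lra.
have e1 := expR_ge1Dx (s * mdist x0 x).
have sd0 : 0 <= s * mdist x0 x by rewrite mulr_ge0// ltW.
have A0_le : A0 <= A0 * expR (s * mdist x0 x).
  by rewrite ler_peMr ?normr_ge0//; lra.
have hd_le : h' * mdist x0 x <= h' / s * expR (s * mdist x0 x).
  rewrite -mulrA ler_wpM2l// mulrC ler_pdivlMr// mulrC; lra.
have := ler_norm (ln (C / v) + h' * Lam - ln q); rewrite -/A0 mulrDl.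
move: lnV; rewrite mulrDr; lra.
Qed.

Lemma integral_gibbs_gap_lty (b : X) :
  (\int[mu]_(x in [set: borel X]) gibbs_gap x0 b x < +oo)%E.
Proof.
(* This [s] puts [p (eps - s)] halfway between [h'] and [p eps]. *)
have [s s0 beta_gt] : exists2 s, 0 < s & h' < p * (eps - s).
  exists ((p * eps - h') / (2 * p)); first by rewrite divr_gt0 ?mulr_gt0// subr_gt0.
  have -> : p * (eps - (p * eps - h') / (2 * p)) = h' + (p * eps - h') / 2.
    by field; rewrite gt_eqF.
  by rewrite ltrDl divr_gt0// subr_gt0.
have [A A0 A_ge] := inverse_temperature_growth s s0.
pose beta := p * (eps - s); pose D := mdist x0 b.
pose K := 2 * (A * expR (eps * D)) / p.
have K0 : 0 <= K by rewrite divr_ge0 ?mulr_ge0 ?expR_ge0// ltW.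
(* Since [(x0|b)_x >= d(x0, x) - D], the kernel decays at rate [eps] in [d(x0, x)], of which the
   inverse temperature takes back [s]. *)
have gap_le x : (gibbs_gap x0 b x <=
    (2 * K `^ p)%:E * (expR (- (beta * mdist x0 x)))%:E)%E.
  apply: le_trans (gibbs_gap_le x0 b x) _; rewrite -EFinM lee_fin -[leRHS]mulrA.
  rewrite ler_pM2l//.
  have -> : expR (- (beta * mdist x0 x)) = expR (- ((eps - s) * mdist x0 x)) `^ p.
    rewrite /powR gt_eqF ?expR_gt0// expRK /beta; congr expR; ring.
  rewrite -powRM ?expR_ge0//; apply: ge0_ler_powR; first exact: ltW.
  - by rewrite nnegrE divr_ge0 ?(ltW p0)// mulr_ge0// mulr_ge0
      ?inverse_temperature_ge0// gromov_kernel_ge0.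
  - by rewrite nnegrE mulr_ge0// expR_ge0.
  rewrite /K [leRHS]mulrAC ler_pM2r ?invr_gt0// -[leRHS]mulrA ler_pM2l//.
  apply: le_trans (ler_pM (inverse_temperature_ge0 x)
    (gromov_kernel_ge0 eps x x0 b) (A_ge x) (_ : _ <= expR (eps * (D - mdist x0 x)))) _.
    rewrite /gromov_kernel ler_expR -mulrN ler_pM2l//.
    have := gromov_product_ge x x0 b; rewrite (metric_sym x x0) -/D; lra.
  rewrite -!mulrA ler_wpM2l// -!expRD ler_expR; lra.
apply: (@le_lt_trans _ _ (\int[mu]_(x in [set: borel X])
    ((2 * K `^ p)%:E * (expR (- (beta * mdist x0 x)))%:E))%E).
  apply: ge0_le_integral => //.
  - by move=> x _; exact: gibbs_gap_ge0.
  - exact: measurable_gibbs_gap.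
  - apply: emeasurable_funM => //; exact: measurable_exp_dist.
rewrite ge0_integralZl_EFin ?mulr_ge0 ?powR_ge0//; last exact: measurable_exp_dist.
apply: lte_mul_pinfty => //; first by rewrite lee_fin mulr_ge0 ?powR_ge0.
exact: (integral_exp_dist mu x0 C h' beta C0 beta_gt h'0 growth).
Qed.

End Finiteness.

(** The density is built from distances and the measure alone, both preserved by [f]. *)
Lemma gibbs_root_equivariant (f f' : X -> X) a x y :
  (forall z w, mdist (f z) (f w) = mdist z w) -> cancel f f' -> cancel f' f ->
  measure_preserving mu (f : borel X -> borel X) ->
  gibbs_root (f a) (f x, f y) = gibbs_root a (x, y).
Proof.
move=> iso fK f'K [mf pf].
have ballE z : f @^-1` ball (f z) Lam = ball z Lam.
  by rewrite !ballEmdist; apply/seteqP; split => w /=; rewrite iso.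
have volE : ball_volume (f x) = ball_volume x.
  rewrite /ball_volume -[in RHS]ballE pf//; exact: measurable_mball.
have weightE z : gibbs_weight (f a) (f x) (f z) = gibbs_weight a x z.
  rewrite /gibbs_weight (visual_dist_isometry eps f f')//.
  rewrite /inverse_temperature volE; congr (_ * _); rewrite !indicE.
  by rewrite -[in RHS]ballE; congr ((nat_of_bool _)%:R); apply/idP/idP => /set_mem ?;
    apply/mem_set.
have partE : partition_function (f a) (f x) = partition_function a x.
  have mW : measurable_fun setT
      (fun z : borel X => (gibbs_weight (f a) (f x) z)%:E).
    by apply/measurable_EFinP; exact: measurable_gibbs_weight_section.
  have W0 (z : borel X) : (0 <= (gibbs_weight (f a) (f x) z)%:E)%E.
    by rewrite lee_fin gibbs_weight_ge0.
  have E := ge0_integral_preserving mu (f : borel X -> borel X) _ (conj mf pf) mW W0.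
  have eqW : (fun z : borel X => (gibbs_weight (f a) (f x) (f z))%:E) =
      (fun z => (gibbs_weight a x z)%:E) by apply/funext => z; rewrite weightE.
  rewrite eqW in E.
  have Ea := partition_functionE a x.
  have Efa := partition_functionE (f a) (f x).
  have EE := etrans (esym E) Ea.
  have EEE := etrans (esym Efa) EE.
  exact: (EFin_inj EEE).
by rewrite /gibbs_root /root_density /= weightE partE.
Qed.

End GibbsStates.

(** * The action on the product *)

Lemma measure_preserving_isometry {R : realType} {X : pmetricType R}
    (mu : {measure set (borel X) -> \bar R}) (f : X -> X) :
  (forall x y, mdist (f x) (f y) = mdist x y) ->
  (forall A : set (borel X), measurable A -> mu (f @^-1` A) = mu A) ->
  measure_preserving mu (f : borel X -> borel X).
Proof.
move=> iso pf; split=> // _; apply: (@measurability _ _ (borel X) (borel X) setT f open) => //.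
move=> _ [U oU <-]; rewrite setTI; apply: sub_sigma_algebra.
rewrite openE => x Ufx; have /nbhs_ballP[r /= r0 rU] := open_nbhs_nbhs (conj oU Ufx).
apply/nbhs_ballP; exists r => // y; rewrite ballEmdist /= => xy.
by apply: rU; rewrite ballEmdist /= iso.
Qed.

(** The section at [x] of the preimage is the preimage of the section at [f x], so invariance is
    used once in each variable. *)
Lemma measure_preserving_prod {R : realType} {d : measure_display}
    {T : measurableType d} (mu : {sigma_finite_measure set T -> \bar R}) (f : T -> T) :
  measure_preserving mu f ->
  measure_preserving (mu \x mu)%E (fun z => (f z.1, f z.2)).
Proof.
move=> [mf pf]; split.
  by apply: measurable_fun_pair; apply: measurableT_comp.
move=> A mA; rewrite /product_measure1.
rewrite -[RHS](ge0_integral_preserving mu f _ (conj mf pf))//.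
  apply: eq_integral => x _ /=.
  rewrite -[RHS](pf _ (measurable_xsection (f x) mA)).
  have -> // : xsection ((fun z => (f z.1, f z.2)) @^-1` A) x =
      f @^-1` xsection A (f x).
  apply/seteqP; split => y.
    by move=> /xsectionP /= ?; apply/xsectionP.
  by move=> /= /xsectionP ?; apply/xsectionP.
exact: measurable_fun_xsection.
Qed.

Lemma sigma_finite_balls {R : realType} {X : pmetricType R}
    (mu : {measure set (borel X) -> \bar R}) (x0 : X) :
  (forall r, (mu (ball x0 r) < +oo)%E) -> sigma_finite setT mu.
Proof.
move=> fin; exists (fun n => ball x0 n%:R) => [|n]; last first.
  by split; [exact: measurable_mball|exact: fin].
apply/seteqP; split => // x _; exists (Num.truncn (mdist x0 x)).+1 => //.
by rewrite ballEmdist /=; have /andP[] := truncn_itv (mdist_ge0 x0 x).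
Qed.

(** * Choice of constants and construction of the action *)

Lemma hyperbolicity_exponent {R : realType} (delta h p : R) :
  0 <= delta -> 0 <= h -> Num.max 1 (h * delta / ln 2) < p ->
  exists eps, [/\ 0 < eps, eps * delta <= ln 2 & h < p * eps].
Proof.
move=> delta0 h0; rewrite gt_max => /andP[p1 hp].
have ln2 : 0 < ln 2 :> R by rewrite ln_gt0// ltr1n.
have p0 : 0 < p by lra.
have [->|delta_neq] := eqVneq delta 0.
  exists (h / p + 1); split.
  - by rewrite ltr_wpDl// divr_ge0// ltW.
  - by rewrite mulr0 ltW.
  - have -> : p * (h / p + 1) = h + p by field; rewrite gt_eqF.
    lra.
have {delta_neq}delta_gt0 : 0 < delta by rewrite lt_neqAle eq_sym delta_neq.
(* The largest [eps] with [eps delta <= ln 2]; the bound on [p] then reads [h < p eps]. *)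
exists (ln 2 / delta); split; first exact: divr_gt0.
  by rewrite divfK// gt_eqF.
by rewrite mulrA ltr_pdivlMr// -ltr_pdivrMr.
Qed.

(** The cocycle is the formal coboundary of [F x0]. Equivariance gives the cocycle identity, and the
    last two hypotheses give values in [L^p] and properness. *)
Lemma acts_properly_on_Lp_of_family {R : realType} {X : metricType R} (x0 : X)
    (G : topologicalGroupType) (act : G -> X -> X) {d : measure_display}
    {Z : measurableType d} (nu : {measure set Z -> \bar R}) (actZ : G -> Z -> Z)
    (p : R) (F : X -> Z -> R) :
  1 <= p -> isometric_action act -> proper_action act ->
  (forall z, actZ 1%g z = z) ->
  (forall g h z, actZ (g * h)%g z = actZ g (actZ h z)) ->
  (forall g, measure_preserving nu (actZ g)) ->
  (forall a, measurable_fun setT (F a)) ->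
  (forall g a z, F (act g a) (actZ g z) = F a z) ->
  (forall b, \int[nu]_z (`|F x0 z - F b z| `^ p)%:E < +oo)%E ->
  (forall M : R, exists D, forall b, D <= mdist x0 b ->
    (M%:E <= \int[nu]_z (`|F x0 z - F b z| `^ p)%:E)%E) ->
  acts_properly_on_Lp G p.
Proof.
move=> p1 isoG properG actZ1 actZM mp mF Fact Ffin Fsep.
have p0 : 0 < p by lra.
pose phi (g : G) z := F (act g x0) z - F x0 z.
have normE g : ('N[nu]_p%:E[EFin \o phi g] =
    (\int[nu]_z (`|F x0 z - F (act g x0) z| `^ p)%:E) `^ p^-1)%E.
  have distE : (\int[nu]_z (`|phi g z| `^ p)%:E =
      \int[nu]_z (`|F x0 z - F (act g x0) z| `^ p)%:E)%E.
    by apply: eq_integral => z _; rewrite /phi distrC.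
  by rewrite LnormE distE.
apply: (acts_properly_on_Lp_of_cocycle nu G p actZ phi) => //.
- move=> g; rewrite inE; apply/andP; split; apply/mem_set => /=.
    exact: measurable_funB.
  by rewrite /finite_norm normE poweR_lty.
- move=> g h z; pose w := actZ g^-1%g z.
  have FE a : F (act g a) z = F a w.
    by rewrite -(Fact g a w) /w -actZM mulgV actZ1.
  by rewrite /phi (isometric_actionM isoG) !FE -/w; ring.
move=> g /(properG x0)/cvgryPge dist_oo; apply/cvgryPge => A.
(* The power anticipates the [p]-th root in the norm. *)
have [D DF] := Fsep (`|A| `^ p).
near=> n; have /DF le_int : D <= mdist x0 (act (g n) x0).
  by near: n; exact: dist_oo.
rewrite normE.
have fin := Ffin (act (g n) x0).
move: le_int fin; set I := (\int[nu]_z _)%E.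
case: I => [r| |] //= le_r _.
rewrite lee_fin in le_r; apply: le_trans (ler_norm A) _.
have -> : `|A| = (`|A| `^ p) `^ p^-1.
  by rewrite -powRrM mulfV ?gt_eqF// powRr1.
apply: ge0_ler_powR => //; rewrite ?invr_ge0 ?nnegrE ?powR_ge0 ?(ltW p0)//.
exact: le_trans (powR_ge0 _ _) le_r.
Unshelve. all: by end_near.
Qed.

Lemma acts_properly_on_Lp_of_growth {R : realType} {X : pmetricType R}
    (mu : {sigma_finite_measure set (borel X) -> \bar R}) (x0 : X)
    (G : topologicalGroupType) (act : G -> X -> X) (eps p delta v rad C h' : R)
    (e : nat -> X) :
  1 <= p -> dense_seq e -> geodesic_space X -> hyperbolic X delta ->
  0 < eps -> eps * delta <= ln 2 -> 0 < v -> 0 < rad ->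
  (forall x, (v%:E <= mu (ball x rad))%E) ->
  0 < C -> 0 <= h' -> h' < p * eps ->
  (forall r, 0 <= r -> (mu (ball x0 r) <= (C * expR (h' * r))%:E)%E) ->
  (forall x r, (mu (ball x r) < +oo)%E) ->
  isometric_action act -> proper_action act ->
  (forall g, measure_preserving mu (act g : borel X -> borel X)) ->
  acts_properly_on_Lp G p.
Proof.
move=> p1 de geo hyp eps0 eps_delta v0 rad0 ball_ge C0 h'0 h'_lt growth ball_fin
  isoG properG mp.
have p0 : 0 < p by lra.
(* Half of the threshold [exp (- eps rad) / 8] below which directions separate. *)
pose kappa := expR (- (eps * rad)) / 16.
have kappa0 : 0 < kappa by rewrite divr_gt0 ?expR_gt0.
(* Ensures [exp (- eps (L - 2 rad)) <= kappa / 2], with the absolute value keeping [L]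
   nonnegative. *)
pose L := 2 * rad + `|ln (2 / kappa)| / eps.
have Lrad : L - 2 * rad = `|ln (2 / kappa)| / eps by rewrite /L; ring.
have L0 : 0 <= L.
  by have := divr_ge0 (normr_ge0 (ln (2 / kappa))) (ltW eps0); rewrite /L; lra.
have kappa_small : 8 * kappa < expR (- (eps * rad)).
  by rewrite /kappa; have := expR_gt0 (- (eps * rad)); lra.
clearbody kappa L.
have L_large : expR (- (eps * (L - 2 * rad))) <= kappa / 2.
  rewrite Lrad mulrC divfK ?gt_eqF//.
  have -> : kappa / 2 = expR (- ln (2 / kappa)).
    rewrite expRN lnK; first by field; rewrite gt_eqF.
    by rewrite posrE divr_gt0.
  by rewrite ler_expR lerN2 ler_norm.
(* The ball around a point within [rad] of [gamma t] then contains the balls of radius [rad] around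
   [gamma (t - L)] and [gamma (t + L)]. *)
pose Lam := L + 2 * rad.
have rad_Lam : rad <= Lam by rewrite /Lam; lra.
have Lam0 : 0 <= Lam by lra.
have gapE := integral_gibbs_gap mu eps p kappa v rad Lam e de eps0 p0 kappa0 v0
  rad_Lam ball_ge ball_fin.
pose actZ g (z : borel X * borel X) : borel X * borel X := (act g z.1, act g z.2).
have actK g : cancel (act g) (act g^-1%g).
  by move=> x; rewrite -(isometric_actionM isoG) mulVg (isometric_action1 isoG).
have actVK g : cancel (act g^-1%g) (act g).
  by move=> x; rewrite -(isometric_actionM isoG) mulgV (isometric_action1 isoG).
apply: (acts_properly_on_Lp_of_family x0 G act (mu \x mu)%E actZ p
  (fun a => gibbs_root mu eps p kappa v Lam a : borel X * borel X -> R)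
  p1 isoG properG).
- by move=> [x y]; rewrite /actZ /= !(isometric_action1 isoG).
- by move=> g h [x y]; rewrite /actZ /= !(isometric_actionM isoG).
- by move=> g; exact: measure_preserving_prod (mp g).
- move=> a; exact: (measurable_gibbs_root mu eps p kappa v rad Lam e de eps0 p0
    kappa0 v0 rad_Lam ball_ge ball_fin a).
- move=> g a [x y].
  exact: (gibbs_root_equivariant mu eps p kappa v rad Lam e de eps0 p0 kappa0 v0
    rad_Lam ball_ge ball_fin (act g) (act g^-1%g) a x y (isometric_action_dist isoG g)
    (actK g) (actVK g) (mp g)).
- move=> b; rewrite gapE.
  exact: (integral_gibbs_gap_lty mu eps p kappa v rad Lam e de eps0 p0 kappa0 v0
    rad_Lam ball_ge ball_fin x0 C h' C0 h'0 h'_lt Lam0 growth b).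
move=> M; pose c := 2 `^ (- p) / 2 * v.
have c0 : 0 < c by rewrite mulr_gt0// divr_gt0// powR_gt0.
pose n := (Num.truncn (`|M| / c)).+1.
exists (2 * L + 2 * rad * n%:R) => b nb; rewrite gapE.
apply: le_trans (integral_gibbs_gap_ge mu eps p kappa v rad Lam e de eps0 p0 kappa0
  v0 rad_Lam ball_ge ball_fin delta eps_delta hyp geo L rad0 L0 (lexx _) kappa_small
  L_large x0 b n nb).
rewrite lee_fin -/c; apply: le_trans (ler_norm M) _.
rewrite mulrC -ler_pdivrMr//; apply: ltW.
by have /andP[] := truncn_itv (divr_ge0 (normr_ge0 M) (ltW c0)).
Qed.

Section SigmaFiniteCopy.
Context {d : measure_display} {T : measurableType d} {R : realType}.
Variables (mu : {measure set T -> \bar R}) (mu_fin : sigma_finite setT mu).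

(** An alias depending on the proof, so that the same measure can carry the sigma-finite structure
    as an instance. *)
Definition sigma_finite_copy of sigma_finite setT mu := (mu : set T -> \bar R).

HB.instance Definition _ := Measure.on (sigma_finite_copy mu_fin).
HB.instance Definition _ := Measure_isSigmaFinite.Build _ _ _
  (sigma_finite_copy mu_fin) mu_fin.

End SigmaFiniteCopy.

Theorem theorem0p1 (R : realType) (delta : R) (X : pmetricType R)
    (mu : {measure set (borel X) -> \bar R}) (x0 : X) (h : R)
    (G : topologicalGroupType) (act : G -> X -> X) (p : R)
    (delta_ge0 : 0 <= delta)
    (X_locally_compact : locally_compact [set: X])
    (X_geodesic : geodesic_space X)
    (X_hyperbolic : hyperbolic X delta)
    (mu_radon : radon_measure mu)
    (mu_non_collapsing : non_collapsing mu)
    (h_ge0 : 0 <= h)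
    (mu_entropy : volume_entropy mu x0 = h%:E)
    (G_second_countable : @second_countable G)
    (G_locally_compact : locally_compact [set: G])
    (G_hausdorff : hausdorff_space G)
    (act_isometric : isometric_action act)
    (act_proper : proper_action act)
    (act_preserves_mu : measure_preserving_action mu act)
    (p_gt : Num.max 1 (h * delta / ln 2) < p) :
  acts_properly_on_Lp G p.
Proof.
have [e de] := geodesic_dense_seq X_locally_compact X_geodesic.
have [eps [eps0 eps_delta h_lt]] := hyperbolicity_exponent delta h p delta_ge0 h_ge0 p_gt.
have p1 : 1 <= p by move: p_gt; rewrite gt_max => /andP[/ltW].
(* A rate above [h] bounds the volume growth, and one below [p eps] makes the gap integrable. *)
pose h' := (h + p * eps) / 2.
have hh' : h < h' by rewrite /h'; lra.
have h'_lt : h' < p * eps by rewrite /h'; lra.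
have h'0 : 0 <= h' by lra.
have [C C0 growth] := volume_entropy_growth mu x0 h h' h_ge0 hh' mu_entropy.
have [rad [v [rad0 v0 ball_ge]]] := mu_non_collapsing.
(* The growth bound is centred at [x0]; every other ball lies in a ball around [x0]. *)
have ball_fin x r : (mu (ball x r) < +oo)%E.
  have D0 : 0 <= `|r| + mdist x0 x by rewrite addr_ge0 ?mdist_ge0.
  apply: le_lt_trans (ltry (C * expR (h' * (`|r| + mdist x0 x)))).
  apply: le_trans (growth _ D0); apply: le_measure_ball => y.
  rewrite !ballEmdist /= => xy; have := metric_triangle x0 x y.
  by have := ler_norm r; lra.
pose mu' : {sigma_finite_measure set (borel X) -> \bar R} :=
  sigma_finite_copy mu (sigma_finite_balls mu x0 (ball_fin x0)).
(* Adding 1 makes the radius positive and keeps the lower bound [v]. *)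
apply: (acts_properly_on_Lp_of_growth mu' x0 G act eps p delta v (rad + 1) C h' e) => //.
- by rewrite ltr_wpDl.
- move=> x; apply: le_trans (ball_ge x) _; apply: le_measure_ball => y.
  by rewrite !ballEmdist /=; lra.
- move=> g; apply: measure_preserving_isometry; first exact: isometric_action_dist.
  by move=> A mA; exact: act_preserves_mu.
Qed.
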